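(* For every $m > 0$ there exists $f \in B(\mathbb R) \setminus A(\mathbb R)$ with $f \geq m$ on $\mathbb R$ whose spectral factor $h$ satisfies $h \in B(\mathbb R) \setminus A(\mathbb R)$.
   Context: $\mathbb U^o := \{z \in \mathbb C : \Im z > 0\}$. For $\omega \in \mathbb R$, $\chi_\omega(x) := e^{i\omega x}$. $C_b(\mathbb R)$ is the space of bounded continuous functions $\mathbb R \to \mathbb C$ with the sup norm. $U(\mathbb R)$, the algebra of uniformly almost periodic functions, is the closure in $C_b(\mathbb R)$, in the sup norm, of the linear span of $\{\chi_\omega : \omega \in \mathbb R\}$. For $f \in U(\mathbb R)$ the mean value $M(f) := \lim_{L\to\infty} \frac{1}{2L}\int_{-L}^L f(x)\,dx$ exists; put $\widehat f(\omega) := M(f\chi_{-\omega})$ for $\omega \in \mathbb R$, the spectrum $\Omega(f) := \{\omega \in \mathbb R : \widehat f(\omega) \neq 0\}$ (a countable set), the bandwidth $b(f) := \sup \Omega(f) - \inf\Omega(f) \in [0,\infty]$, and $\|f\|_A := \sum_{\omega\in\Omega(f)} |\widehat f(\omega)| \in [0,\infty]$. Then $B(\mathbb R) := \{f \in U(\mathbb R) : b(f) < \infty\}$ and $A(\mathbb R) := \{f \in U(\mathbb R) : \|f\|_A < \infty\}$. An entire function $F \not\equiv 0$ is of exponential type if $\tau(F) := \limsup_{r\to\infty} r^{-1}\log \max_{|z|\leq r}|F(z)|$ is finite; $\tau(F)$ is its type. Every $f \in B(\mathbb R)$ extends to an entire function $F$ of exponential type. Spectral factor: if $f \in B(\mathbb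 R)$ is nonzero and $f \geq 0$, with entire extension $F$ (for which $\tau(F) = b(f)/2$), a spectral factor of $f$ is a function $s : \mathbb R \to \mathbb C$ with $f = |s|^2$ that extends to an entire function $S$ of exponential type with $\tau(S) = \tau(F)/2 = b(f)/4$ and having no zeros in $\mathbb U^o$. (A spectral factor exists and is unique up to multiplication by a constant of modulus $1$, so membership in $B(\mathbb R)$ or $A(\mathbb R)$ does not depend on the choice.) *)

(* Defs.v *)
(* Stdlib reals with Coquelicot. *)
From Stdlib Require Import Reals List.
From Coquelicot Require Export Coquelicot.
Open Scope R_scope.

Definition chi (w x : R) : C := (cos (w * x), sin (w * x)).

Definition sup_norm (f : R -> C) : Rbar :=
  Lub_Rbar (fun y => exists x, y = Cmod (f x)).

Definition in_Cb (f : R -> C) : Prop :=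
  (forall x, continuous f x) /\ Rbar_lt (sup_norm f) p_infty.

(* The linear span of the characters: sum of c * chi w over the pairs (c, w). *)
Definition trig_poly (l : list (C * R)) (x : R) : C :=
  fold_right (fun p acc => Cplus (Cmult (fst p) (chi (snd p) x)) acc)
    (RtoC 0) l.

Definition in_U (f : R -> C) : Prop :=
  in_Cb f /\
  forall eps : R, 0 < eps ->
    exists l : list (C * R),
      Rbar_lt (sup_norm (fun x => Cminus (f x) (trig_poly l x))) eps.

Definition average (f : R -> C) (L : R) : C :=
  scal (/ (2 * L)) (RInt (V := C_R_CompleteNormedModule) f (- L) L).

(* The limit of the averages, taken componentwise. [Lim] and [RInt] are total,
   so the value is meaningful only when the limit exists, as it does for every
   f in U. *)
Definition mean (f : R -> C) : C :=
  (real (Lim (fun L => Re (average f L)) p_infty),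
   real (Lim (fun L => Im (average f L)) p_infty)).

Definition fourier (f : R -> C) (w : R) : C :=
  mean (fun x => Cmult (f x) (chi (- w) x)).

Definition spectrum (f : R -> C) (w : R) : Prop := fourier f w <> RtoC 0.

(* For empty spectrum (f = 0) this evaluates to m_infty, since the supremum and
   infimum of the empty set are m_infty and p_infty; so f = 0 is band-limited,
   just as with the convention that its bandwidth is 0. *)
Definition bandwidth (f : R -> C) : Rbar :=
  Rbar_minus (Lub_Rbar (spectrum f)) (Glb_Rbar (spectrum f)).

(* The unordered sum of |fourier f w| over the spectrum, in [0, +infinity]:
   the supremum of the sums over finite subsets of the spectrum. *)
Definition A_norm (f : R -> C) : Rbar :=
  Lub_Rbar (fun y => exists l : list R,
    NoDup l /\ List.Forall (spectrum f) l /\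
    y = fold_right (fun w acc => Cmod (fourier f w) + acc) 0 l).

Definition in_B (f : R -> C) : Prop :=
  in_U f /\ Rbar_lt (bandwidth f) p_infty.

Definition in_A (f : R -> C) : Prop :=
  in_U f /\ Rbar_lt (A_norm f) p_infty.

Definition entire (F : C -> C) : Prop := forall z : C, ex_derive F z.

(* The supremum is a maximum, hence finite, when F is continuous and r >= 0. *)
Definition max_modulus (F : C -> C) (r : R) : R :=
  real (Lub_Rbar (fun y => exists z : C, Cmod z <= r /\ y = Cmod (F z))).

Definition limsup_p_infty (g : R -> R) : Rbar :=
  Rbar_glb (fun s => exists r0 : R, 0 < r0 /\
    s = Lub_Rbar (fun y => exists r, r0 <= r /\ y = g r)).

Definition type_of (F : C -> C) : Rbar :=
  limsup_p_infty (fun r => / r * ln (max_modulus F r)).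

Definition exponential_type (F : C -> C) : Prop :=
  entire F /\ (exists z, F z <> RtoC 0) /\ is_finite (type_of F).

Definition extends (F : C -> C) (f : R -> C) : Prop :=
  forall x : R, F (RtoC x) = f x.

Definition ge_const (f : R -> C) (m : R) : Prop :=
  forall x : R, Im (f x) = 0 /\ m <= Re (f x).

(* [s] is a spectral factor of the nonzero, nonnegative function [f] in B.
   The entire extensions [F] and [S] are unique by the identity theorem. *)
Definition spectral_factor (f s : R -> C) : Prop :=
  in_B f /\ (exists x, f x <> RtoC 0) /\ ge_const f 0 /\
  (forall x, f x = RtoC (Cmod (s x) ^ 2)) /\
  exists F S : C -> C,
    exponential_type F /\ extends F f /\
    exponential_type S /\ extends S s /\
    type_of S = Rbar_div (type_of F) 2 /\
    type_of S = Rbar_div (bandwidth f) 4 /\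
    (forall z : C, 0 < Im z -> S z <> RtoC 0).

(* Main.v *)
Require Import Defs.
From Stdlib Require Import Reals List FinFun Arith Lra Lia.
From Coquelicot Require Import Coquelicot.
Open Scope R_scope.

(** The idea is to choose the factor first. Let g be almost periodic with
    spectrum in [2, 3], bounded by 20, with Fourier coefficients that are not
    absolutely summable, and with an extension G that is bounded by 20 on the upper
    half-plane too. For c >= 21 the function c + G has no zeros there, so
    h(x) = e^(-3ix/2) (c + g(x)) is a spectral factor of f = |h|^2 = |c + g|^2, and
    f >= (c - 20)^2. Neither function is in A: the coefficients of h are those of g,
    translated, together with c; and in f = c^2 + c g + c conj(g) + |g|^2 the last
    term has its spectrum in [-1, 1], the set of differences of points of [2, 3], so
    the coefficients of f on [2, 3] are exactly c times those of g.

    To build g, weighted Rudin-Shapiro polynomials are summed. The polynomial with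
    2^k coefficients +1 or -1 is bounded by 2 (3/2)^k on the closed unit disc
    ([rudin_shapiro_bound]), so with weight (3/5)^k the blocks converge uniformly,
    geometrically with ratio 9/10, on the upper half-plane, while the absolute
    values of the coefficients of block k sum to (6/5)^k. Block k is modulated to
    frequencies in a cluster of width less than (1/4)^k just above 2 + (1/4)^k; the
    clusters are disjoint, so the Fourier coefficients are those of the blocks
    ([blocks_coef], [fourier_of_approx]).

    The Rudin-Shapiro estimate, with the obvious growth factor, holds in the lower
    half-plane as well, which gives the upper bounds on the types; the lower bounds
    come from the imaginary axis, on which the top frequency 3 dominates
    ([type_of_factor_ext], [type_of_square_ext]). The series G is entire because the
    clusters are so narrow that the second-order Taylor remainders of the blocks
    are again geometrically summable ([block_taylor], [quadratic_at_Gsum]). *)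

(** * Complex numbers and elementary estimates *)

Lemma C_eq (z w : C) : Re z = Re w -> Im z = Im w -> z = w.
Proof. destruct z, w; simpl; intros; subst; reflexivity. Qed.

Lemma Cmod_le_sq (z : C) (r : R) : 0 <= r -> Cmod z ^ 2 <= r ^ 2 -> Cmod z <= r.
Proof. intros Hr H. pose proof (Cmod_ge_0 z). nra. Qed.

Lemma Cmod_le_abs (z : C) : Cmod z <= Rabs (Re z) + Rabs (Im z).
Proof.
  pose proof (Rabs_pos (Re z)). pose proof (Rabs_pos (Im z)).
  apply Cmod_le_sq; [lra|]. rewrite Cmod2_alt, <- (pow2_abs (Re z)), <- (pow2_abs (Im z)). nra.
Qed.

Lemma Im_le_Cmod (z : C) : Rabs (Im z) <= Cmod z.
Proof. eapply Rle_trans; [apply Rmax_r | apply (Rmax_Cmod z)]. Qed.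

Lemma Cmod_sub_ge (a b : C) : Cmod a - Cmod b <= Cmod (a + b).
Proof.
  pose proof (Cmod_triangle (a + b) (- b)). rewrite Cmod_opp in H.
  replace (a + b + - b)%C with a in H by ring. lra.
Qed.

Lemma nonzero_of_Cmod (z : C) (r : R) : 0 < r -> Cmod z = r -> z <> RtoC 0.
Proof. intros Hr H E. rewrite E, Cmod_0 in H. lra. Qed.

Lemma exp_le (x y : R) : x <= y -> exp x <= exp y.
Proof. intros [H|H]; [left; apply exp_increasing; exact H | rewrite H; lra]. Qed.

Lemma pow_le_1 (a : R) (k : nat) : 0 <= a <= 1 -> 0 <= a ^ k <= 1.
Proof. intros H. split; [apply pow_le; lra|]. rewrite <- (pow1 k). apply pow_incr. lra. Qed.

Lemma geometric_small (K eps : R) : 0 < K -> 0 < eps -> exists N, forall n, (N <= n)%nat -> K * (9 / 10) ^ n <= eps.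
Proof.
  intros HK He. destruct (pow_lt_1_zero (9 / 10) ltac:(rewrite Rabs_pos_eq; lra) (eps / K)) as [N HN].
  { apply Rdiv_lt_0_compat; lra. }
  exists N. intros n Hn. specialize (HN n Hn).
  rewrite Rabs_pos_eq in HN by (apply pow_le; lra).
  apply (Rmult_lt_compat_l K) in HN; [|lra]. unfold Rdiv in HN at 2.
  replace (K * (eps * / K)) with eps in HN by (field; lra). lra.
Qed.

(** * Exponentials of complex argument *)

(** The character [chi w], continued to the function e^(iwz) on the plane. *)
Definition cexpi (w : R) (z : C) : C :=
  (exp (- (w * Im z)) * cos (w * Re z), exp (- (w * Im z)) * sin (w * Re z)).

Lemma cexpi_real (w x : R) : cexpi w (RtoC x) = chi w x.
Proof.
  apply C_eq; simpl; rewrite Rmult_0_r, Ropp_0, exp_0; ring.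
Qed.

Lemma cexpi_add (w : R) (z h : C) : cexpi w (z + h) = (cexpi w z * cexpi w h)%C.
Proof.
  apply C_eq; unfold cexpi, Re, Im; simpl;
  rewrite !Rmult_plus_distr_l, ?Ropp_plus_distr, exp_plus, ?cos_plus, ?sin_plus; ring.
Qed.

Lemma cexpi_freq_add (w v : R) (z : C) : cexpi (w + v) z = (cexpi w z * cexpi v z)%C.
Proof.
  apply C_eq; unfold cexpi, Re, Im; simpl;
  rewrite !Rmult_plus_distr_r, ?Ropp_plus_distr, exp_plus, ?cos_plus, ?sin_plus; ring.
Qed.

Lemma cexpi_0 (z : C) : cexpi 0 z = RtoC 1.
Proof.
  apply C_eq; unfold cexpi, Re, Im; simpl;
  rewrite !Rmult_0_l, Ropp_0, exp_0, ?cos_0, ?sin_0; ring.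
Qed.

Lemma cexpi_neg (w : R) (z : C) : cexpi (- w) z = cexpi w (- z).
Proof.
  apply C_eq; unfold cexpi, Re, Im; simpl; f_equal; f_equal; ring.
Qed.

Lemma Cmod_cexpi (w : R) (z : C) : Cmod (cexpi w z) = exp (- (w * Im z)).
Proof.
  unfold cexpi. set (e := exp _). assert (0 < e) by apply exp_pos.
  replace (e * cos (w * Re z), e * sin (w * Re z)) with
    (RtoC e * (cos (w * Re z), sin (w * Re z)))%C by (apply C_eq; simpl; ring).
  rewrite Cmod_mult, Cmod_R, Rabs_pos_eq by lra.
  unfold Cmod; cbn [fst snd].
  rewrite <- (Rsqr_pow2 (cos _)), <- (Rsqr_pow2 (sin _)), Rplus_comm, sin2_cos2, sqrt_1; ring.
Qed.

Lemma Cmod_chi (w x : R) : Cmod (chi w x) = 1.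
Proof. rewrite <- cexpi_real, Cmod_cexpi. simpl. rewrite Rmult_0_r, Ropp_0. apply exp_0. Qed.

(** Growth in the lower half-plane is recorded by a bound M on - Im z; taking
    M = 0 gives boundedness on the closed upper half-plane, and both half-planes
    are then treated by one estimate. *)
Lemma Cmod_cexpi_le (w : R) (z : C) (M : R) :
  0 <= w -> - Im z <= M -> Cmod (cexpi w z) <= exp (w * M).
Proof.
  intros Hw HM. rewrite Cmod_cexpi.
  apply exp_le. nra.
Qed.

(** The inequality 1 - x <= exp (- x), inverted. *)
Lemma exp_le_inv_1m (x : R) : x < 1 -> exp x <= / (1 - x).
Proof.
  intros H. pose proof (exp_ineq1_le (- x)). rewrite exp_Ropp in H0.
  pose proof (exp_pos x). 
  rewrite <- (Rinv_inv (exp x)). apply Rinv_le_contravar; lra.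
Qed.

Lemma exp_taylor (x : R) : Rabs x <= 1 / 2 -> 0 <= exp x - 1 - x <= 2 * x ^ 2.
Proof.
  intros H. apply Rabs_le_between in H. pose proof (exp_ineq1_le x). split; [lra|].
  pose proof (exp_le_inv_1m x ltac:(lra)).
  assert (/ (1 - x) <= 1 + x + 2 * x ^ 2); [|lra].
  apply Rmult_le_reg_l with (1 - x); [lra|]. rewrite Rinv_r by lra. nra.
Qed.

Lemma cos_taylor (y : R) : Rabs y <= 1 / 2 -> 0 <= 1 - cos y <= y ^ 2 / 2.
Proof.
  intros H. apply Rabs_le_between in H. pose proof (COS_bound y). split; [lra|].
  destruct (pre_cos_bound y 0 ltac:(lra) ltac:(lra)) as [H1 _].
  unfold cos_approx, cos_term in H1; simpl in H1. lra.
Qed.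

Lemma sin_taylor_pos (y : R) : 0 <= y <= 1 / 2 -> y - y ^ 2 <= sin y <= y.
Proof.
  intros H. destruct (pre_sin_bound y 0 ltac:(lra) ltac:(lra)) as [H1 H2].
  unfold sin_approx, sin_term in H1, H2; simpl in H1, H2.
  assert (y ^ 3 <= y ^ 2) by (simpl; nra). assert (0 <= y ^ 3) by (apply pow_le; lra).
  assert (y ^ 5 <= y ^ 3) by (replace (y^5) with (y ^ 3 * y ^ 2) by ring; assert (y^2<=1) by nra; nra).
  simpl in *. split; lra.
Qed.

Lemma sin_taylor (y : R) : Rabs y <= 1 / 2 -> Rabs (sin y) <= Rabs y /\ Rabs (sin y - y) <= y ^ 2.
Proof.
  intros H. apply Rabs_le_between in H.
  destruct (Rle_lt_dec 0 y) as [Hy|Hy].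
  - destruct (sin_taylor_pos y); [lra|]. split.
    + rewrite (Rabs_pos_eq y) by lra. apply Rabs_le. nra.
    + apply Rabs_le. nra.
  - destruct (sin_taylor_pos (- y)); [lra|]. rewrite sin_neg in *. split.
    + rewrite (Rabs_left y) by lra. apply Rabs_le. nra.
    + apply Rabs_le. nra.
Qed.

(** The factor w ^ 2 matters: it makes the second-order remainder of a sum over
    a tight cluster of small frequencies small even when the sum is long. *)
Lemma cexpi_taylor (w : R) (h : C) : Rabs w * Cmod h <= 1 / 2 ->
  Cmod (cexpi w h - 1 - h * (Ci * w)) <= 4 * (w ^ 2 * Cmod h ^ 2).
Proof.
  intros H.
  set (x := - (w * Im h)). set (y := w * Re h).
  assert (Hx : Rabs x <= 1 / 2).
  { unfold x. rewrite Rabs_Ropp, Rabs_mult. pose proof (Im_le_Cmod h). pose proof (Rabs_pos w). nra. }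
  assert (Hy : Rabs y <= 1 / 2).
  { unfold y. rewrite Rabs_mult. pose proof (re_le_Cmod h). pose proof (Rabs_pos w). nra. }
  assert (Hs : w ^ 2 * Cmod h ^ 2 = x ^ 2 + y ^ 2) by (rewrite Cmod2_alt; unfold x, y; ring).
  rewrite Hs.
  destruct (exp_taylor x Hx). destruct (cos_taylor y Hy). destruct (sin_taylor y Hy).
  apply Rabs_le_between in Hx. apply Rabs_le_between in Hy.
  assert (exp x <= 2) by nra. pose proof (exp_pos x).
  assert (Rabs (exp x - 1) <= 2 * Rabs x).
  { unfold Rabs; destruct (Rcase_abs (exp x - 1)), (Rcase_abs x); nra. }
  eapply Rle_trans; [apply Cmod_le_abs|].
  replace (Re (cexpi w h - 1 - h * (Ci * w))) with ((exp x - 1 - x) - exp x * (1 - cos y))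
    by (unfold x, y, cexpi, Re, Im; simpl; ring).
  replace (Im (cexpi w h - 1 - h * (Ci * w))) with ((exp x - 1) * sin y + (sin y - y))
    by (unfold x, y, cexpi, Re, Im; simpl; ring).
  assert (Rabs ((exp x - 1 - x) - exp x * (1 - cos y)) <= 2 * x ^ 2 + y ^ 2) by (apply Rabs_le; nra).
  assert (Rabs ((exp x - 1) * sin y + (sin y - y)) <= 2 * (Rabs x * Rabs y) + y ^ 2).
  { eapply Rle_trans; [apply Rabs_triang|]. rewrite Rabs_mult.
    assert (Rabs (exp x - 1) * Rabs (sin y) <= 2 * Rabs x * Rabs y)
      by (apply Rmult_le_compat; auto using Rabs_pos).
    lra. }
  assert (2 * (Rabs x * Rabs y) <= x ^ 2 + y ^ 2).
  { pose proof (pow2_ge_0 (Rabs x - Rabs y)). pose proof (pow2_abs x). pose proof (pow2_abs y). nra. }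
  nra.
Qed.

(** * Finite exponential sums *)

(** The entire extension of [trig_poly l]. *)
Definition exp_sum (l : list (C * R)) (z : C) : C :=
  fold_right (fun p acc => fst p * cexpi (snd p) z + acc)%C (RtoC 0) l.

Lemma exp_sum_real (l : list (C * R)) (x : R) : exp_sum l (RtoC x) = trig_poly l x.
Proof.
  induction l as [|p l IH]; [reflexivity|]. unfold exp_sum, trig_poly in *; simpl.
  rewrite IH, cexpi_real. reflexivity.
Qed.

Definition shift (v : R) (l : list (C * R)) : list (C * R) :=
  map (fun p => (fst p, v + snd p)) l.

Definition scale (c : C) (l : list (C * R)) : list (C * R) :=
  map (fun p => (c * fst p, snd p)%C) l.

Definition reflect (l : list (C * R)) : list (C * R) :=
  map (fun p => (fst p, - snd p)) l.

Fixpoint product (l1 l2 : list (C * R)) : list (C * R) :=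
  match l1 with
  | nil => nil
  | p :: l => scale (fst p) (shift (snd p) l2) ++ product l l2
  end.

Definition deriv_sum (l : list (C * R)) : list (C * R) :=
  map (fun p : C * R => (fst p * (Ci * snd p), snd p)%C) l.

Lemma exp_sum_app (l1 l2 : list (C * R)) (z : C) :
  exp_sum (l1 ++ l2) z = (exp_sum l1 z + exp_sum l2 z)%C.
Proof. induction l1 as [|p l IH]; simpl; [ring|]. rewrite IH. ring. Qed.

Lemma exp_sum_shift (v : R) (l : list (C * R)) (z : C) :
  exp_sum (shift v l) z = (cexpi v z * exp_sum l z)%C.
Proof. induction l as [|p l IH]; simpl; [ring|]. rewrite IH, cexpi_freq_add. ring. Qed.

Lemma exp_sum_scale (c : C) (l : list (C * R)) (z : C) :
  exp_sum (scale c l) z = (c * exp_sum l z)%C.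
Proof. induction l as [|p l IH]; simpl; [ring|]. rewrite IH. ring. Qed.

Lemma exp_sum_reflect (l : list (C * R)) (z : C) :
  exp_sum (reflect l) z = exp_sum l (- z).
Proof. induction l as [|p l IH]; simpl; [ring|]. rewrite IH, cexpi_neg. ring. Qed.

Lemma exp_sum_product (l1 l2 : list (C * R)) (z : C) :
  exp_sum (product l1 l2) z = (exp_sum l1 z * exp_sum l2 z)%C.
Proof.
  induction l1 as [|p l IH]; simpl; [ring|].
  rewrite exp_sum_app, exp_sum_scale, exp_sum_shift, IH. ring.
Qed.

(** Real coefficients give the symmetry that turns |g|^2 on the real line into
    g(x) g(-x), which continues analytically. *)
Lemma exp_sum_real_conj (l : list (C * R)) (x : R) :
  List.Forall (fun p : C * R => Im (fst p) = 0) l ->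
  exp_sum l (- RtoC x) = Cconj (exp_sum l (RtoC x)).
Proof.
  induction 1 as [|p l Hp _ IH]; [apply C_eq; simpl; ring|].
  simpl exp_sum. rewrite IH, <- RtoC_opp, !cexpi_real.
  apply C_eq; unfold Re, Im in *; simpl; rewrite Hp, Ropp_mult_distr_r_reverse, ?cos_neg, ?sin_neg; ring.
Qed.

Lemma exp_sum_bound (l : list (C * R)) (A mu M : R) (z : C) :
  0 <= A -> 0 <= M -> - Im z <= M ->
  List.Forall (fun p : C * R => Cmod (fst p) <= A /\ 0 <= snd p <= mu) l ->
  Cmod (exp_sum l z) <= INR (length l) * A * exp (mu * M).
Proof.
  intros HA HM Hz HF. pose proof (exp_pos (mu * M)). induction HF as [|p l [H1 H2] HF IH].
  - simpl. rewrite Cmod_0. lra.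
  - change (length (p :: l)) with (S (length l)). rewrite S_INR.
    simpl exp_sum. eapply Rle_trans; [apply Cmod_triangle|]. rewrite Cmod_mult.
    pose proof (Cmod_cexpi_le (snd p) z M ltac:(lra) Hz).
    pose proof (exp_le (snd p * M) (mu * M) ltac:(nra)).
    pose proof (Cmod_ge_0 (cexpi (snd p) z)). pose proof (Cmod_ge_0 (fst p)).
    assert (Cmod (fst p) * Cmod (cexpi (snd p) z) <= A * exp (mu * M)) by (apply Rmult_le_compat; lra).
    nra.
Qed.

Lemma exp_sum_taylor (l : list (C * R)) (mu M : R) (z h : C) :
  0 <= M -> - Im z <= M -> mu * Cmod h <= 1 / 2 ->
  List.Forall (fun p : C * R => Cmod (fst p) <= 1 /\ 0 <= snd p <= mu) l ->
  Cmod (exp_sum l (z + h) - exp_sum l z - h * exp_sum (deriv_sum l) z)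
    <= INR (length l) * (4 * mu ^ 2 * exp (mu * M)) * Cmod h ^ 2.
Proof.
  intros HM Hz Hh HF. pose proof (exp_pos (mu * M)). induction HF as [|p l [H1 H2] HF IH].
  - simpl. replace (_ - _ - _)%C with (RtoC 0) by ring. rewrite Cmod_0. lra.
  - change (length (p :: l)) with (S (length l)). rewrite S_INR.
    simpl exp_sum. rewrite cexpi_add.
    match goal with |- Cmod ?t <= _ => replace t with
      (fst p * cexpi (snd p) z * (cexpi (snd p) h - 1 - h * (Ci * snd p)) + 
       (exp_sum l (z + h) - exp_sum l z - h * exp_sum (deriv_sum l) z))%C by ring end.
    eapply Rle_trans; [apply Cmod_triangle|]. rewrite !Cmod_mult.
    pose proof (Cmod_ge_0 h).
    pose proof (cexpi_taylor (snd p) h ltac:(rewrite Rabs_pos_eq by lra; nra)) as HT.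
    pose proof (Cmod_cexpi_le (snd p) z M ltac:(lra) Hz).
    pose proof (exp_le (snd p * M) (mu * M) ltac:(nra)).
    pose proof (Cmod_ge_0 (cexpi (snd p) z)). pose proof (Cmod_ge_0 (fst p)).
    assert (Cmod (fst p) * Cmod (cexpi (snd p) z) <= 1 * exp (mu * M)) by (apply Rmult_le_compat; lra).
    assert (Cmod (cexpi (snd p) h - 1 - h * (Ci * snd p)) <= 4 * (mu ^ 2 * Cmod h ^ 2)).
    { eapply Rle_trans; [exact HT|].
      assert (snd p ^ 2 <= mu ^ 2) by nra. assert (0 <= Cmod h ^ 2) by nra. nra. }
    pose proof (Cmod_ge_0 (cexpi (snd p) h - 1 - h * (Ci * snd p))).
    assert (Cmod (fst p) * Cmod (cexpi (snd p) z) * Cmod (cexpi (snd p) h - 1 - h * (Ci * snd p)) <= 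
      (1 * exp (mu * M)) * (4 * (mu ^ 2 * Cmod h ^ 2))) by (apply Rmult_le_compat; nra).
    nra.
Qed.

(** * Coefficients of exponential sums *)

(** A frequency may be listed several times, so its coefficient is the sum over
    all its occurrences. *)
Definition coef (l : list (C * R)) (w : R) : C :=
  fold_right (fun p acc => if Req_EM_T (snd p) w then (fst p + acc)%C else acc) (RtoC 0) l.

Lemma coef_app (l1 l2 : list (C * R)) (w : R) : coef (l1 ++ l2) w = (coef l1 w + coef l2 w)%C.
Proof. induction l1 as [|p l IH]; simpl; [ring|]. rewrite IH. destruct Req_EM_T; ring. Qed.

Lemma coef_absent (l : list (C * R)) (w : R) :
  List.Forall (fun p : C * R => snd p <> w) l -> coef l w = RtoC 0.
Proof. induction 1 as [|p l H HF IH]; simpl; [reflexivity|]. destruct Req_EM_T; [tauto|exact IH]. Qed.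

Lemma coef_shift (v : R) (l : list (C * R)) (w : R) : coef (shift v l) w = coef l (w - v).
Proof.
  induction l as [|p l IH]; simpl; [reflexivity|]. rewrite IH.
  destruct (Req_EM_T (v + snd p) w), (Req_EM_T (snd p) (w - v)); try reflexivity; exfalso; lra.
Qed.

Lemma coef_reflect (l : list (C * R)) (w : R) : coef (reflect l) w = coef l (- w).
Proof.
  induction l as [|p l IH]; simpl; [reflexivity|]. rewrite IH.
  destruct (Req_EM_T (- snd p) w), (Req_EM_T (snd p) (- w)); try reflexivity; exfalso; lra.
Qed.

Lemma coef_scale (c : C) (l : list (C * R)) (w : R) : coef (scale c l) w = (c * coef l w)%C.
Proof.
  induction l as [|p l IH]; simpl; [ring|]. rewrite IH. destruct Req_EM_T; ring.
Qed.

Lemma coef_in (l : list (C * R)) (c : C) (w : R) :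
  NoDup (map snd l) -> In (c, w) l -> coef l w = c.
Proof.
  induction l as [|p l IH]; simpl; [tauto|]. intros HN [H|H]; inversion HN as [|? ? Hn HN']; subst.
  - simpl. destruct Req_EM_T; [|tauto]. rewrite coef_absent; [ring|].
    apply Forall_forall. intros q Hq E. apply Hn. rewrite in_map_iff. exists q. auto.
  - destruct Req_EM_T as [E|E]; [|auto]. exfalso. apply Hn. rewrite E.
    apply in_map_iff. exists (c, w). auto.
Qed.

(** The coefficient of a product is a convolution; here the differences between w
    and the frequencies of [l] meet the spectrum of [l2] at most at 0. *)
Lemma coef_product_diag (l l2 : list (C * R)) (w : R) (c : C) :
  List.Forall (fun p : C * R => coef l2 (w - snd p) = if Req_EM_T (snd p) w then c else RtoC 0) l ->
  coef (product l l2) w = (c * coef l w)%C.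
Proof.
  induction 1 as [|p l Hp _ IH]; simpl; [ring|].
  rewrite coef_app, coef_scale, coef_shift, Hp, IH. destruct Req_EM_T; ring.
Qed.

(** * Mean values and Fourier coefficients *)

Lemma norm_C_R (z : C_R_NormedModule) : norm z = Cmod z.
Proof. symmetry. apply Cmod_norm. Qed.

Lemma is_RInt_Cmult (f : R -> C) (a b : R) (c I : C) :
  is_RInt (V := C_R_NormedModule) f a b I ->
  is_RInt (V := C_R_NormedModule) (fun x => c * f x)%C a b (c * I)%C.
Proof.
  intros H.
  assert (H1 : is_RInt (fun x => fst (f x)) a b (fst I)) by (apply (is_RInt_fct_extend_fst f a b I H)).
  assert (H2 : is_RInt (fun x => snd (f x)) a b (snd I)) by (apply (is_RInt_fct_extend_snd f a b I H)).
  apply (is_RInt_fct_extend_pair (U := R_NormedModule) (V := R_NormedModule)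
    (fun x => c * f x)%C a b (fst (c * I)%C) (snd (c * I)%C)); simpl.
  - apply (is_RInt_minus (V := R_NormedModule)); apply (is_RInt_scal (V := R_NormedModule)); assumption.
  - apply (is_RInt_plus (V := R_NormedModule)); apply (is_RInt_scal (V := R_NormedModule)); assumption.
Qed.

Lemma is_RInt_chi (w L : R) : w <> 0 ->
  is_RInt (V := C_R_NormedModule) (chi w) (- L) L (RtoC (2 * sin (w * L) / w)).
Proof.
  intros Hw.
  apply (is_RInt_fct_extend_pair (U := R_NormedModule) (V := R_NormedModule)
    (chi w) (- L) L (2 * sin (w * L) / w) 0); simpl.
  - replace (2 * sin (w * L) / w) with (minus (sin (w * L) / w) (sin (w * - L) / w)).
    2:{ unfold minus, plus, opp; simpl. rewrite <- Ropp_mult_distr_r, sin_neg. field; auto. }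
    apply (is_RInt_derive (V := R_CompleteNormedModule) (fun x => sin (w * x) / w)).
    + intros x _. auto_derive; [auto|]. field; auto.
    + intros x _. apply (ex_derive_continuous (V := R_NormedModule)). auto_derive; auto.
  - replace 0 with (minus (- cos (w * L) / w) (- cos (w * - L) / w)).
    2:{ unfold minus, plus, opp; simpl. rewrite <- Ropp_mult_distr_r, cos_neg. field; auto. }
    apply (is_RInt_derive (V := R_CompleteNormedModule) (fun x => - cos (w * x) / w)).
    + intros x _. auto_derive; [auto|]. field; auto.
    + intros x _. apply (ex_derive_continuous (V := R_NormedModule)). auto_derive; auto.
Qed.

(** Every non-constant character has a bounded primitive, so the integral over
    [-L, L] differs by O(1) from the contribution of frequency 0. *)
Lemma RInt_trig_poly (l : list (C * R)) :
  exists K, 0 <= K /\ forall L, 0 < L -> exists I : C,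
    is_RInt (V := C_R_NormedModule) (trig_poly l) (- L) L I /\
    Cmod (I - 2 * L * coef l 0) <= K.
Proof.
  induction l as [|[c w] l [K [HK IH]]].
  - exists 0. split; [lra|]. intros L HL. exists (RtoC 0). split.
    + replace (RtoC 0) with (scal (L - - L) (zero : C_R_NormedModule))
        by (apply C_eq; exact (Rmult_0_r _)).
      apply (is_RInt_const (V := C_R_NormedModule)).
    + simpl. replace (_ - _)%C with (RtoC 0) by ring. rewrite Cmod_0. lra.
  - destruct (Req_EM_T w 0) as [Hw|Hw].
    + exists K. split; [lra|]. intros L HL. destruct (IH L HL) as [I [HI HB]].
      exists (c * (2 * L) + I)%C. split.
      * apply (is_RInt_plus (V := C_R_NormedModule)); [|exact HI].
        apply is_RInt_Cmult.
        apply is_RInt_ext with (fun _ => RtoC 1).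
        { intros x _. simpl. rewrite Hw, <- cexpi_real. symmetry. apply cexpi_0. }
        replace (2 * L)%C with (scal (L - - L) (RtoC 1 : C_R_NormedModule)).
        apply (is_RInt_const (V := C_R_NormedModule)).
        apply C_eq; unfold Re, Im; simpl; unfold scal; simpl; unfold mult; simpl; ring.
      * simpl. destruct Req_EM_T; [|tauto].
        replace (_ - _)%C with (I - 2 * L * coef l 0)%C by ring. exact HB.
    + exists (Cmod c * (2 / Rabs w) + K). pose proof (Cmod_ge_0 c). pose proof (Rabs_pos_lt w Hw).
      assert (0 < 2 / Rabs w) by (apply Rdiv_lt_0_compat; lra).
      split; [nra|]. intros L HL. destruct (IH L HL) as [I [HI HB]].
      exists (c * RtoC (2 * sin (w * L) / w) + I)%C. split.
      * apply (is_RInt_plus (V := C_R_NormedModule)); [|exact HI].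
        apply is_RInt_Cmult. apply is_RInt_chi; exact Hw.
      * simpl. destruct Req_EM_T; [tauto|].
        replace (_ - _)%C with (c * RtoC (2 * sin (w * L) / w) + (I - 2 * L * coef l 0))%C by ring.
        eapply Rle_trans; [apply Cmod_triangle|]. apply Rplus_le_compat; [|exact HB].
        rewrite Cmod_mult. apply Rmult_le_compat_l; [auto|].
        rewrite Cmod_R. unfold Rdiv. rewrite !Rabs_mult, Rabs_inv.
        rewrite (Rabs_pos_eq 2) by lra.
        assert (Rabs (sin (w * L)) <= 1) by (apply Rabs_le; apply SIN_bound).
        apply Rmult_le_compat_r; [left; apply Rinv_0_lt_compat; lra|]. lra.
Qed.

Lemma is_lim_eps (u : R -> R) (c : R) :
  (forall eps, 0 < eps -> exists A, forall L, A < L -> Rabs (u L - c) <= eps) ->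
  is_lim u p_infty c.
Proof.
  intros H. apply is_lim_spec. intros eps.
  destruct (H (eps / 2)) as [A HA]; [destruct eps; simpl; lra|].
  exists A. intros L HL. destruct eps as [e He]; simpl in *. specialize (HA L HL). lra.
Qed.

(** A uniform error eps in f costs eps in every average, and the averages of the
    trigonometric polynomial tend to its coefficient at 0. *)
Lemma average_approx (f : R -> C) (l : list (C * R)) (eps : R) :
  0 < eps -> (forall x, continuous f x) ->
  (forall x, Cmod (f x - trig_poly l x) <= eps) ->
  exists A, forall L, A < L -> Cmod (average f L - coef l 0) <= 2 * eps.
Proof.
  intros He Hc Hf. destruct (RInt_trig_poly l) as [K [HK HI]].
  exists (Rmax 0 (K / (2 * eps))). intros L HL.
  assert (0 < L) by (eapply Rle_lt_trans; [apply Rmax_l|exact HL]).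
  assert (HL2 : K / (2 * eps) < L) by (eapply Rle_lt_trans; [apply Rmax_r|exact HL]).
  destruct (HI L H) as [I [HI1 HI2]].
  destruct (ex_RInt_continuous (V := C_R_CompleteNormedModule) f (- L) L) as [J HJ].
  { intros; apply Hc. }
  unfold average. rewrite (is_RInt_unique _ _ _ _ HJ).
  pose proof (is_RInt_minus (V := C_R_NormedModule) _ _ _ _ _ _ HJ HI1) as HD.
  pose proof (norm_RInt_le_const (V := C_R_NormedModule) _ (- L) L _ eps ltac:(lra)
     (fun x _ => eq_ind_r (fun t => t <= eps) (Hf x) (norm_C_R _)) HD) as HN.
  rewrite norm_C_R in HN. change (Cmod (J - I) <= (L - - L) * eps) in HN.
  match goal with |- Cmod ?t <= _ =>
    replace t with (RtoC (/ (2 * L)) * ((J - I) + (I - 2 * L * coef l 0)))%C end.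
  2:{ match goal with |- context [scal ?a ?b] =>
        change (scal a b) with (/ (2 * L) * Re J, / (2 * L) * Im J) end.
      apply C_eq; unfold Re, Im; simpl; field; lra. }
  rewrite Cmod_mult, Cmod_R. rewrite Rabs_pos_eq by (left; apply Rinv_0_lt_compat; lra).
  apply Rmult_le_reg_l with (2 * L); [lra|]. rewrite <- Rmult_assoc, Rinv_r, Rmult_1_l by lra.
  pose proof (Cmod_triangle (J - I) (I - 2 * L * coef l 0)).
  assert (K < L * (2 * eps)).
  { apply Rmult_lt_reg_r with (/ (2 * eps)); [apply Rinv_0_lt_compat; lra|].
    rewrite Rmult_assoc, Rinv_r, Rmult_1_r by lra. exact HL2. }
  nra.
Qed.

Lemma mean_of_approx (f : R -> C) (c : C) :
  (forall x, continuous f x) ->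
  (forall eps, 0 < eps -> exists l, coef l 0 = c /\
     forall x, Cmod (f x - trig_poly l x) <= eps) ->
  mean f = c.
Proof.
  intros Hc H.
  assert (HA : forall eps, 0 < eps -> exists A, forall L, A < L -> Cmod (average f L - c) <= eps).
  { intros eps He. destruct (H (eps / 2)) as [l [Hl Hf]]; [lra|].
    destruct (average_approx f l (eps / 2) ltac:(lra) Hc Hf) as [A HA].
    exists A. intros L HL. rewrite <- Hl. specialize (HA L HL). lra. }
  unfold mean. apply C_eq; simpl.
  - rewrite (is_lim_unique _ _ (Re c)); [reflexivity|].
    apply is_lim_eps. intros eps He. destruct (HA eps He) as [A HL]. exists A. intros L H0.
    eapply Rle_trans; [|apply (HL L H0)]. apply (re_le_Cmod (average f L - c)).
  - rewrite (is_lim_unique _ _ (Im c)); [reflexivity|].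
    apply is_lim_eps. intros eps He. destruct (HA eps He) as [A HL]. exists A. intros L H0.
    eapply Rle_trans; [|apply (HL L H0)]. apply (Im_le_Cmod (average f L - c)).
Qed.

Lemma continuous_C (f : R -> C) (x : R) :
  (forall eps, 0 < eps -> exists d, 0 < d /\ forall y, Rabs (y - x) < d -> Cmod (f y - f x) <= eps) ->
  continuous f x.
Proof.
  intros H. apply filterlim_locally. intros eps.
  destruct (H (eps / 2)) as [d [Hd Hy]]; [destruct eps; simpl; lra|].
  exists (mkposreal d Hd). intros y Hy'. 
  apply C_NormedModule_mixin_compat1. 
  eapply Rle_lt_trans; [apply Hy; exact Hy'|]. destruct eps; simpl; lra.
Qed.

Lemma continuous_C_pair (u v : R -> R) (x : R) :
  continuous u x -> continuous v x -> continuous (fun t => (u t, v t) : C) x.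
Proof.
  intros Hu Hv. apply filterlim_locally. intros eps.
  apply filter_and; [apply (proj1 (filterlim_locally u (u x)) Hu eps)
                    |apply (proj1 (filterlim_locally v (v x)) Hv eps)].
Qed.

Lemma chi_continuous (w x : R) : continuous (chi w) x.
Proof.
  apply continuous_C_pair;
  apply (ex_derive_continuous (V := R_NormedModule)); auto_derive; auto.
Qed.

Lemma continuous_C_fst_snd (f : R -> C) (x : R) : continuous f x ->
  continuous (fun t => fst (f t)) x /\ continuous (fun t => snd (f t)) x.
Proof.
  intros H. split; apply filterlim_locally; intros eps;
  apply (filter_imp (fun t => ball (f x) eps (f t)));
  try (apply (proj1 (filterlim_locally f (f x)) H eps)); intros t [H1 H2]; assumption.
Qed.

Lemma continuous_Cmult (f g : R -> C) (x : R) :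
  continuous f x -> continuous g x -> continuous (fun x => f x * g x)%C x.
Proof.
  intros Hf Hg.
  destruct (continuous_C_fst_snd f x Hf), (continuous_C_fst_snd g x Hg).
  apply continuous_C_pair.
  - apply (continuous_minus (V := R_NormedModule)); apply (continuous_mult (K := R_AbsRing)); assumption.
  - apply (continuous_plus (V := R_NormedModule)); apply (continuous_mult (K := R_AbsRing)); assumption.
Qed.

Lemma trig_poly_shift (v : R) (l : list (C * R)) (x : R) :
  trig_poly (shift v l) x = (chi v x * trig_poly l x)%C.
Proof. rewrite <- !exp_sum_real, exp_sum_shift, cexpi_real. reflexivity. Qed.

(** Fourier coefficients are read off from uniform approximations whose
    coefficient at w is already the right one. Multiplying by [chi (- w)] moves w
    to 0 and keeps the approximation uniform. *)
Lemma fourier_of_approx (f : R -> C) (w : R) (c : C) :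
  (forall x, continuous f x) ->
  (forall eps, 0 < eps -> exists l, coef l w = c /\
     forall x, Cmod (f x - trig_poly l x) <= eps) ->
  fourier f w = c.
Proof.
  intros Hc H. apply mean_of_approx.
  - intros x. apply continuous_Cmult; [apply Hc | apply chi_continuous].
  - intros eps He. destruct (H eps He) as [l [Hl Hf]].
    exists (shift (- w) l). split.
    + rewrite coef_shift, <- Hl. f_equal. ring.
    + intros x. rewrite trig_poly_shift.
      replace (_ - _)%C with (chi (- w) x * (f x - trig_poly l x))%C by ring.
      rewrite Cmod_mult, Cmod_chi, Rmult_1_l. apply Hf.
Qed.

(** * Membership in the spaces U, B and A *)

Lemma sup_norm_le (f : R -> C) (B : R) :
  (forall x, Cmod (f x) <= B) -> Rbar_le (sup_norm f) B.
Proof.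
  intros H. destruct (Lub_Rbar_correct (fun y => exists x, y = Cmod (f x))) as [_ Hl].
  apply Hl. intros y [x ->]. apply H.
Qed.

Lemma in_U_of_approx (f : R -> C) (B : R) :
  (forall x, continuous f x) -> (forall x, Cmod (f x) <= B) ->
  (forall eps, 0 < eps -> exists l, forall x, Cmod (f x - trig_poly l x) <= eps) ->
  in_U f.
Proof.
  intros Hc HB H. split; [split; [exact Hc|]|].
  - eapply Rbar_le_lt_trans; [apply sup_norm_le, HB | exact I].
  - intros eps He. destruct (H (eps / 2)) as [l Hl]; [lra|]. exists l.
    eapply Rbar_le_lt_trans; [apply sup_norm_le, Hl|]. simpl; lra.
Qed.

Lemma bandwidth_eq (f : R -> C) (a b : R) :
  (forall w, spectrum f w -> a <= w <= b) -> spectrum f a -> spectrum f b ->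
  bandwidth f = Finite (b - a).
Proof.
  intros H Ha Hb. unfold bandwidth.
  rewrite (is_lub_Rbar_unique _ b).
  2:{ split; [intros w Hw; simpl; apply H; auto | intros u Hu; apply Hu; auto]. }
  rewrite (is_glb_Rbar_unique _ a).
  2:{ split; [intros w Hw; simpl; apply H; auto | intros u Hu; apply Hu; auto]. }
  reflexivity.
Qed.

(** It suffices to exhibit finite parts of the spectrum with arbitrarily large
    sums. *)
Lemma not_in_A_of_unbounded (f : R -> C) :
  (forall B, exists l : list R, NoDup l /\ List.Forall (spectrum f) l /\
     B <= fold_right (fun w acc => Cmod (fourier f w) + acc) 0 l) ->
  ~ in_A f.
Proof.
  intros H [_ HA]. unfold A_norm in HA.
  set (E := fun y => exists l : list R, NoDup l /\ List.Forall (spectrum f) l /\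
    y = fold_right (fun w acc => Cmod (fourier f w) + acc) 0 l) in *.
  destruct (Lub_Rbar_correct E) as [Hub _].
  assert (Hall : forall B : R, Rbar_le B (Lub_Rbar E)).
  { intros B. destruct (H B) as [l [H1 [H2 H3]]].
    eapply Rbar_le_trans; [|apply Hub; exists l; auto]. exact H3. }
  destruct (Lub_Rbar E) as [b| |]; simpl in *; try tauto.
  - specialize (Hall (b + 1)). lra.
  - exact (Hall 0).
Qed.

(** * Rudin-Shapiro polynomials *)

(** The Rudin-Shapiro polynomials p + w^N q and p - w^N q, N = 2 ^ n, as
    exponential sums in w = e^(i lam z). *)
Fixpoint rudin_shapiro (lam : R) (n : nat) : list (C * R) * list (C * R) :=
  match n with
  | O => ((RtoC 1, 0) :: nil, (RtoC 1, 0) :: nil)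
  | S n =>
      let (p, q) := rudin_shapiro lam n in
      let q' := shift (2 ^ n * lam) q in
      (p ++ q', p ++ scale (- RtoC 1)%C q')
  end.

Lemma map_snd_shift (v : R) (l : list (C * R)) :
  map snd (shift v l) = map (Rplus v) (map snd l).
Proof. unfold shift. rewrite !map_map. reflexivity. Qed.

Lemma map_snd_scale (c : C) (l : list (C * R)) : map snd (scale c l) = map snd l.
Proof. unfold scale. rewrite !map_map. reflexivity. Qed.

Lemma INR_pow2 (n : nat) : INR (2 ^ n) = 2 ^ n.
Proof. rewrite pow_INR. reflexivity. Qed.

Lemma seq_shift_add (a n : nat) : seq a n = map (Nat.add a) (seq 0 n).
Proof.
  revert a. induction n as [|n IH]; intros a; [reflexivity|]. simpl.
  rewrite (IH (S a)), (IH 1%nat), map_map, Nat.add_0_r. f_equal.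
  apply map_ext. intros; lia.
Qed.

Lemma rudin_shapiro_freqs (lam : R) (n : nat) :
  map snd (fst (rudin_shapiro lam n)) = map (fun j => INR j * lam) (seq 0 (2 ^ n)) /\
  map snd (snd (rudin_shapiro lam n)) = map (fun j => INR j * lam) (seq 0 (2 ^ n)).
Proof.
  induction n as [|n [IHp IHq]].
  - simpl. rewrite Rmult_0_l. auto.
  - simpl rudin_shapiro. destruct (rudin_shapiro lam n) as [p q]; simpl fst in *; simpl snd in *.
    assert (E : map (fun j => INR j * lam) (seq 0 (2 ^ S n)) =
      map snd p ++ map (Rplus (2 ^ n * lam)) (map snd q)).
    { replace (2 ^ S n)%nat with (2 ^ n + 2 ^ n)%nat by (simpl; lia).
      rewrite seq_app, map_app, IHp, IHq, Nat.add_0_l, (seq_shift_add (2 ^ n)), !map_map.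
      f_equal. apply map_ext. intros j. rewrite plus_INR, INR_pow2. ring. }
    rewrite E, !map_app, map_snd_scale, map_snd_shift. auto.
Qed.

Lemma rudin_shapiro_length (lam : R) (n : nat) :
  length (fst (rudin_shapiro lam n)) = (2 ^ n)%nat.
Proof.
  rewrite <- (length_map snd), (proj1 (rudin_shapiro_freqs lam n)), length_map, length_seq. reflexivity.
Qed.

Lemma rudin_shapiro_coefs (lam : R) (n : nat) :
  List.Forall (fun p : C * R => Cmod (fst p) = 1 /\ Im (fst p) = 0) (fst (rudin_shapiro lam n)) /\
  List.Forall (fun p : C * R => Cmod (fst p) = 1 /\ Im (fst p) = 0) (snd (rudin_shapiro lam n)).
Proof.
  induction n as [|n [IHp IHq]].
  - simpl. split; constructor; auto using Cmod_1.
  - simpl rudin_shapiro. destruct (rudin_shapiro lam n) as [p q]; simpl fst in *; simpl snd in *.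
    rewrite Forall_forall in IHp, IHq.
    split; apply Forall_forall; intros x; rewrite in_app_iff; unfold scale, shift;
      rewrite ?map_map, in_map_iff; intros [H|[y [<- Hy]]]; auto; [exact (IHq y Hy)|].
    destruct (IHq y Hy) as [H1 H2].
    change (Cmod (- RtoC 1 * fst y) = 1 /\ Im (- RtoC 1 * fst y)%C = 0).
    rewrite Cmod_mult, Cmod_opp, Cmod_1, H1. unfold Im, Re in *. simpl. rewrite H2. split; ring.
Qed.

Lemma Cmod_parallelogram (a b : C) :
  Cmod (a + b) ^ 2 + Cmod (a - b) ^ 2 = 2 * (Cmod a ^ 2 + Cmod b ^ 2).
Proof. rewrite !Cmod2_alt. unfold Re, Im. simpl. ring. Qed.

(** The parallelogram law doubles |p|^2 + |q|^2 at each step when |w| = 1. Off the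
    circle the factor |w^N|^2 is at most exp (2 N lam M), and the exponents N add
    up to the degree 2 ^ n - 1. *)
Lemma rudin_shapiro_parallelogram (lam M : R) (n : nat) (z : C) :
  0 <= lam -> 0 <= M -> - Im z <= M ->
  Cmod (exp_sum (fst (rudin_shapiro lam n)) z) ^ 2 +
  Cmod (exp_sum (snd (rudin_shapiro lam n)) z) ^ 2
    <= 2 ^ S n * exp (2 * ((2 ^ n - 1) * lam * M)).
Proof.
  intros Hl HM Hz. induction n as [|n IH].
  - simpl. rewrite !cexpi_0. replace (1 * 1 + 0)%C with (RtoC 1) by ring.
    rewrite Cmod_1. replace (2 * ((1 - 1) * lam * M)) with 0 by ring. rewrite exp_0. lra.
  - simpl rudin_shapiro. destruct (rudin_shapiro lam n) as [p q]; simpl fst in *; simpl snd in *.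
    rewrite !exp_sum_app, exp_sum_scale, exp_sum_shift.
    set (e := cexpi (2 ^ n * lam) z).
    replace (exp_sum p z + - (1) * (e * exp_sum q z))%C with (exp_sum p z - e * exp_sum q z)%C by ring.
    rewrite Cmod_parallelogram, Cmod_mult.
    assert (H2 : 1 <= 2 ^ n) by (apply pow_R1_Rle; lra).
    assert (He : Cmod e <= exp (2 ^ n * lam * M)) by (apply Cmod_cexpi_le; nra).
    pose proof (Cmod_ge_0 e). pose proof (exp_ineq1_le (2 ^ n * lam * M)).
    assert (0 <= lam * M) by nra. assert (0 <= 2 ^ n * (lam * M)) by nra.
    set (E := exp (2 ^ n * lam * M)) in *.
    assert (1 <= E) by lra.
    replace (exp (2 * ((2 ^ S n - 1) * lam * M))) with (E ^ 2 * exp (2 * ((2 ^ n - 1) * lam * M))).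
    2:{ unfold E. replace (exp (2 ^ n * lam * M) ^ 2) with (exp (2 ^ n * lam * M + 2 ^ n * lam * M))
          by (rewrite exp_plus; ring). rewrite <- exp_plus. f_equal. simpl; ring. }
    assert ((Cmod e * Cmod (exp_sum q z)) ^ 2 <= E ^ 2 * Cmod (exp_sum q z) ^ 2).
    { rewrite Rpow_mult_distr. apply Rmult_le_compat_r; [apply pow2_ge_0|]. apply pow_incr; lra. }
    assert (Cmod (exp_sum p z) ^ 2 <= E ^ 2 * Cmod (exp_sum p z) ^ 2).
    { rewrite <- (Rmult_1_l (Cmod _ ^ 2)) at 1. apply Rmult_le_compat_r; [apply pow2_ge_0|]. nra. }
    apply (Rmult_le_compat_l (2 * E ^ 2)) in IH; [|nra].
    replace (2 ^ S (S n)) with (2 * 2 ^ S n) by (simpl; ring). lra.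
Qed.

(** The square root of the previous estimate, with 3/2 in place of sqrt 2; this
    still beats the trivial bound 2 ^ n, which is all that is needed. *)
Lemma rudin_shapiro_bound (lam M : R) (n : nat) (z : C) :
  0 <= lam -> 0 <= M -> - Im z <= M ->
  Cmod (exp_sum (fst (rudin_shapiro lam n)) z) <= 2 * (3 / 2) ^ n * exp ((2 ^ n - 1) * lam * M).
Proof.
  intros Hl HM Hz. pose proof (rudin_shapiro_parallelogram lam M n z Hl HM Hz) as H.
  pose proof (exp_pos ((2 ^ n - 1) * lam * M)).
  assert (0 < (3 / 2) ^ n) by (apply pow_lt; lra).
  apply Cmod_le_sq; [nra|].
  pose proof (pow2_ge_0 (Cmod (exp_sum (snd (rudin_shapiro lam n)) z))).
  rewrite !Rpow_mult_distr.
  replace (2 * ((2 ^ n - 1) * lam * M)) with ((2 ^ n - 1) * lam * M + (2 ^ n - 1) * lam * M) in H by ring.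
  rewrite exp_plus in H.
  assert (Hn : 2 ^ n <= ((3 / 2) ^ n) ^ 2).
  { rewrite <- pow_mult, Nat.mul_comm, pow_mult. apply pow_incr. lra. }
  set (E := exp _) in *. assert (0 < E ^ 2) by nra.
  assert (2 ^ n * E ^ 2 <= ((3 / 2) ^ n) ^ 2 * E ^ 2) by (apply Rmult_le_compat_r; lra).
  assert (0 < 2 ^ n) by (apply pow_lt; lra).
  simpl (2 ^ S n) in H. nra.
Qed.

(** * Blocks with disjoint clusters of frequencies *)

(** The weight (3/5)^k is chosen so that (3/5)(3/2) = 9/10 < 1, which makes the
    sup norms summable, while 2 (3/5) = 6/5 > 1, which makes the sums of the
    absolute values of the 2 ^ k coefficients unbounded. The step (1/8)^k makes
    the block a cluster of width less than (1/4)^k, which keeps the blocks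
    disjoint and makes trivial bounds on the derivatives summable. All
    frequencies lie in [2, 3], and block 0 is the single frequency 3. *)
Definition block (k : nat) : list (C * R) :=
  scale (RtoC ((3 / 5) ^ k)) (shift (2 + (1 / 4) ^ k) (fst (rudin_shapiro ((1 / 8) ^ k) k))).

Definition block_freq (k j : nat) : R := 2 + (1 / 4) ^ k + INR j * (1 / 8) ^ k.

(** The largest frequency of block k, since j runs up to 2 ^ k - 1. *)
Definition block_top (k : nat) : R := 2 + (1 / 4) ^ k + (2 ^ k - 1) * (1 / 8) ^ k.

Lemma pow2_pow8 (k : nat) : 2 ^ k * (1 / 8) ^ k = (1 / 4) ^ k.
Proof. rewrite <- Rpow_mult_distr. f_equal. lra. Qed.

Lemma block_top_0 : block_top 0 = 3.
Proof. unfold block_top; simpl; ring. Qed.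

(** The clusters are disjoint and decrease towards 2. *)
Lemma block_top_lt (j k : nat) : (j < k)%nat -> block_top k < 2 + (1 / 4) ^ j.
Proof.
  intros H. unfold block_top. rewrite Rmult_minus_distr_r, pow2_pow8.
  assert (0 < (1 / 8) ^ k) by (apply pow_lt; lra).
  assert ((1 / 4) ^ k <= 1 / 4 * (1 / 4) ^ j).
  { change (1 / 4 * (1 / 4) ^ j) with ((1 / 4) ^ S j).
    replace k with (S j + (k - S j))%nat by lia. rewrite pow_add.
    pose proof (pow_le_1 (1 / 4) (S j) ltac:(lra)). pose proof (pow_le_1 (1 / 4) (k - S j) ltac:(lra)).
    nra. }
  assert (0 < (1 / 4) ^ j) by (apply pow_lt; lra). lra.
Qed.

Lemma block_top_le_3 (k : nat) : block_top k <= 3.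
Proof.
  destruct k as [|k]; [rewrite block_top_0; lra|].
  pose proof (block_top_lt 0 (S k) ltac:(lia)). simpl (_ ^ 0) in H. lra.
Qed.

(** The gap between 5/2 and 3 isolates the top frequency 3, and this is what
    determines the growth of the series in the lower half-plane. *)
Lemma block_top_S (k : nat) : block_top (S k) <= 5 / 2.
Proof.
  unfold block_top. rewrite Rmult_minus_distr_r, pow2_pow8.
  assert (0 < (1 / 8) ^ S k) by (apply pow_lt; lra).
  pose proof (pow_le_1 (1 / 4) k ltac:(lra)). simpl (_ ^ S k) in *. lra.
Qed.

Lemma block_freq_le (k j : nat) : (j < 2 ^ k)%nat ->
  2 + (1 / 4) ^ k <= block_freq k j <= block_top k.
Proof.
  intros H. unfold block_freq, block_top.
  assert (0 < (1 / 8) ^ k) by (apply pow_lt; lra).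
  pose proof (pos_INR j).
  assert (INR j <= 2 ^ k - 1).
  { apply le_INR in H. rewrite S_INR, INR_pow2 in H. lra. }
  nra.
Qed.

Lemma block_freq_range (k j : nat) : (j < 2 ^ k)%nat -> 2 <= block_freq k j <= 3.
Proof.
  intros H. pose proof (block_freq_le k j H). pose proof (block_top_le_3 k).
  assert (0 < (1 / 4) ^ k) by (apply pow_lt; lra). lra.
Qed.

Lemma block_freq_0 : block_freq 0 0 = 3.
Proof. unfold block_freq; simpl; ring. Qed.

Lemma block_freqs (k : nat) : map snd (block k) = map (block_freq k) (seq 0 (2 ^ k)).
Proof.
  unfold block. rewrite map_snd_scale, map_snd_shift, (proj1 (rudin_shapiro_freqs _ _)), map_map.
  reflexivity.
Qed.

Lemma block_freq_inj (k i j : nat) : block_freq k i = block_freq k j -> i = j.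
Proof.
  unfold block_freq. intros H. apply INR_eq.
  assert (0 < (1 / 8) ^ k) by (apply pow_lt; lra).
  apply Rmult_eq_reg_r with ((1 / 8) ^ k); lra.
Qed.

Lemma block_freqs_NoDup (k : nat) : NoDup (map snd (block k)).
Proof.
  rewrite block_freqs. apply Injective_map_NoDup; [|apply seq_NoDup].
  intros i j. apply block_freq_inj.
Qed.

Lemma block_range (k : nat) :
  List.Forall (fun p : C * R => 2 + (1 / 4) ^ k <= snd p <= block_top k) (block k).
Proof.
  apply Forall_forall. intros p Hp.
  assert (H : In (snd p) (map snd (block k))) by (apply in_map; exact Hp).
  rewrite block_freqs, in_map_iff in H. destruct H as [j [<- Hj]].
  apply block_freq_le. apply in_seq in Hj. lia.
Qed.

Lemma block_coef (k j : nat) : (j < 2 ^ k)%nat ->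
  Cmod (coef (block k) (block_freq k j)) = (3 / 5) ^ k.
Proof.
  intros Hj.
  assert (H : In (block_freq k j) (map snd (block k))).
  { rewrite block_freqs. apply in_map. apply in_seq. lia. }
  apply in_map_iff in H. destruct H as [[c w] [Hw Hin]]. simpl in Hw. subst w.
  rewrite (coef_in _ c _ (block_freqs_NoDup k) Hin).
  unfold block, scale in Hin. apply in_map_iff in Hin. destruct Hin as [[c' w'] [E Hin]].
  simpl in E. injection E as <- _.
  unfold shift in Hin. apply in_map_iff in Hin. destruct Hin as [[c2 w2] [E2 Hin]].
  simpl in E2. injection E2 as <- _.
  pose proof (proj1 (rudin_shapiro_coefs ((1 / 8) ^ k) k)) as HF. rewrite Forall_forall in HF.
  specialize (HF _ Hin). destruct HF as [HF _]. simpl in HF.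
  rewrite Cmod_mult, HF, Cmod_R, Rabs_pos_eq; [ring|]. apply pow_le; lra.
Qed.

Lemma block_coefs_real (k : nat) : List.Forall (fun p : C * R => Im (fst p) = 0) (block k).
Proof.
  apply Forall_forall. intros p Hp. unfold block, scale, shift in Hp.
  rewrite map_map, in_map_iff in Hp. destruct Hp as [q [<- Hq]].
  pose proof (proj1 (rudin_shapiro_coefs ((1 / 8) ^ k) k)) as H. rewrite Forall_forall in H.
  destruct (H q Hq) as [_ H0]. unfold Im in *; simpl. rewrite H0. ring.
Qed.

Lemma block_bound (k : nat) (z : C) (M : R) : 0 <= M -> - Im z <= M ->
  Cmod (exp_sum (block k) z) <= 2 * (9 / 10) ^ k * exp (block_top k * M).
Proof.
  intros HM Hz. unfold block. rewrite exp_sum_scale, exp_sum_shift, !Cmod_mult, Cmod_R.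
  assert (0 < (3 / 5) ^ k) by (apply pow_lt; lra). rewrite Rabs_pos_eq by lra.
  assert (0 < (1 / 4) ^ k) by (apply pow_lt; lra).
  assert (0 < (1 / 8) ^ k) by (apply pow_lt; lra).
  pose proof (Cmod_cexpi_le (2 + (1 / 4) ^ k) z M ltac:(lra) Hz).
  pose proof (rudin_shapiro_bound ((1 / 8) ^ k) M k z ltac:(lra) HM Hz).
  unfold block_top. rewrite Rmult_plus_distr_r, exp_plus.
  replace (9 / 10) with (3 / 5 * (3 / 2)) by field. rewrite Rpow_mult_distr.
  match goal with |- _ <= 2 * (?a * ?b) * (?c * ?d) =>
    replace (2 * (a * b) * (c * d)) with (a * (c * (2 * b * d))) by ring end.
  apply Rmult_le_compat_l; [lra|]. apply Rmult_le_compat; auto using Cmod_ge_0.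
Qed.

Fixpoint blocks (n : nat) : list (C * R) :=
  match n with O => nil | S n => block n ++ blocks n end.

Lemma blocks_range (n : nat) :
  List.Forall (fun p : C * R => 2 <= snd p <= 3) (blocks n).
Proof.
  induction n as [|n IH]; [constructor|]. simpl. apply Forall_app. split; [|exact IH].
  eapply Forall_impl; [|apply block_range]. intros p [H1 H2].
  pose proof (block_top_le_3 n). assert (0 < (1 / 4) ^ n) by (apply pow_lt; lra). lra.
Qed.

Lemma block_coef_other (i k j : nat) : i <> k -> (j < 2 ^ k)%nat ->
  coef (block i) (block_freq k j) = RtoC 0.
Proof.
  intros Hik Hj. apply coef_absent. eapply Forall_impl; [|apply block_range].
  intros p [H1 H2] E. rewrite E in *. pose proof (block_freq_le k j Hj).
  destruct (proj1 (Nat.lt_gt_cases i k) Hik) as [H0|H0]; pose proof (block_top_lt _ _ H0); lra.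
Qed.

Lemma blocks_coef (n k j : nat) : (j < 2 ^ k)%nat ->
  coef (blocks n) (block_freq k j) =
    if lt_dec k n then coef (block k) (block_freq k j) else RtoC 0.
Proof.
  intros Hj. induction n as [|n IH]; [reflexivity|]. simpl blocks. rewrite coef_app, IH.
  destruct (Nat.eq_dec n k) as [->|E].
  - destruct (lt_dec k k); [lia|]. destruct (lt_dec k (S k)); [ring|lia].
  - rewrite block_coef_other by auto.
    destruct (lt_dec k n), (lt_dec k (S n)); try lia; ring.
Qed.

Lemma blocks_coef_out (n : nat) (w : R) : ~ (2 <= w <= 3) -> coef (blocks n) w = RtoC 0.
Proof.
  intros H. apply coef_absent. eapply Forall_impl; [|apply blocks_range].
  intros p [H1 H2] E. apply H. lra.
Qed.

Lemma blocks_coef_in (n k j : nat) : (j < 2 ^ k)%nat -> (S k <= n)%nat ->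
  coef (blocks n) (block_freq k j) = coef (block k) (block_freq k j).
Proof. intros H H1. rewrite blocks_coef by exact H. destruct lt_dec; [reflexivity|lia]. Qed.

(** * Series of complex numbers *)

(** The sum is taken componentwise in order to have a total function; it is the
    limit in C for the geometrically dominated series considered here. *)
Definition Csum (a : nat -> C) : C := (Series (fun k => Re (a k)), Series (fun k => Im (a k))).

Definition is_Cseries (a : nat -> C) (l : C) : Prop := is_series (V := C_NormedModule) a l.

Lemma sum_n_fst_snd (a : nat -> C) (n : nat) :
  sum_n (G := C_AbelianMonoid) a n = (sum_n (fun k => Re (a k)) n, sum_n (fun k => Im (a k)) n).
Proof.
  induction n as [|n IH]; [rewrite !sum_O; destruct (a 0%nat); reflexivity|].
  rewrite !sum_Sn, IH. reflexivity.
Qed.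

Lemma is_Cseries_Csum (a : nat -> C) (K q : R) :
  0 <= q < 1 -> (forall k, Cmod (a k) <= K * q ^ k) -> is_Cseries a (Csum a).
Proof.
  intros Hq Ha.
  destruct (ex_series_le (V := C_CompleteNormedModule) a (fun k => K * q ^ k)) as [l Hl].
  - intros n. eapply Rle_trans; [|apply Ha]. right. reflexivity.
  - apply (ex_series_scal (V := R_NormedModule) K (fun k => q ^ k)), ex_series_geom.
    rewrite Rabs_pos_eq; lra.
  - replace (Csum a) with (l : C); [exact Hl|].
    assert (Hb : forall eps : posreal, eventually (fun n => ball (l : C) eps 
      (sum_n (G := C_AbelianMonoid) a n))).
    { intros eps. apply (proj1 (filterlim_locally _ _) Hl eps). }
    apply C_eq; simpl; symmetry; apply is_series_unique; apply filterlim_locally; intros eps;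
    (apply (filter_imp _ _) with (2 := Hb eps)); intros n; rewrite sum_n_fst_snd; intros [H1 H2]; assumption.
Qed.

Lemma sum_n_geom_bound (a : nat -> C) (K q : R) (n : nat) :
  0 <= q < 1 -> 0 <= K -> (forall k, Cmod (a k) <= K * q ^ k) ->
  Cmod (sum_n (G := C_AbelianMonoid) a n) <= K * (1 - q ^ S n) / (1 - q).
Proof.
  intros Hq HK Ha. induction n as [|n IH].
  - rewrite sum_O. eapply Rle_trans; [apply Ha|]. simpl. right. field. lra.
  - rewrite sum_Sn. eapply Rle_trans; [apply Cmod_triangle|].
    eapply Rle_trans; [apply Rplus_le_compat; [exact IH|apply Ha]|].
    right. simpl. field. lra.
Qed.

Lemma Cseries_bound (a : nat -> C) (l : C) (K q : R) :
  0 <= q < 1 -> 0 <= K -> (forall k, Cmod (a k) <= K * q ^ k) -> is_Cseries a l ->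
  Cmod l <= K / (1 - q).
Proof.
  intros Hq HK Ha Hl. apply Rle_plus_epsilon. intros eps He.
  assert (He2 : 0 < eps / 2) by lra.
  destruct (proj1 (filterlim_locally _ _) Hl (mkposreal _ He2)) as [N HN].
  specialize (HN N (Nat.le_refl N)).
  pose proof (C_NormedModule_mixin_compat2 _ _ _ HN) as HB.
  set (s := sum_n (G := C_AbelianMonoid) a N) in *.
  change (Cmod (s - l) < sqrt 2 * (eps / 2)) in HB.
  assert (sqrt 2 <= 2) by (replace 2 with (sqrt (2 * 2)) at 2 by (apply sqrt_square; lra); apply sqrt_le_1; lra).
  assert (Cmod (s - l) <= eps) by (pose proof (sqrt_pos 2); nra).
  pose proof (sum_n_geom_bound a K q N Hq HK Ha). fold s in H1.
  assert (K * (1 - q ^ S N) / (1 - q) <= K / (1 - q)).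
  { unfold Rdiv. apply Rmult_le_compat_r; [left; apply Rinv_0_lt_compat; lra|].
    assert (0 <= q ^ S N) by (apply pow_le; lra). nra. }
  pose proof (Cmod_triangle s (- (s - l))). rewrite Cmod_opp in H3.
  replace (s + - (s - l))%C with l in H3 by ring. lra.
Qed.

(** * The series of blocks *)

(** The analytic continuation of the counterexample g: the blocks converge
    geometrically, although the series of all single terms does not converge
    absolutely. *)
Definition Gsum (z : C) : C := Csum (fun k => exp_sum (block k) z).

Lemma block_top_mono_exp (k : nat) (M : R) : 0 <= M -> exp (block_top k * M) <= exp (3 * M).
Proof. intros HM. apply exp_le. pose proof (block_top_le_3 k). nra. Qed.

Lemma Gsum_series (z : C) : is_Cseries (fun k => exp_sum (block k) z) (Gsum z).
Proof.
  set (M := Rabs (Im z)). pose proof (Rabs_pos (Im z)).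
  apply is_Cseries_Csum with (K := 2 * exp (3 * M)) (q := 9 / 10); [lra|].
  intros k. eapply Rle_trans; [apply (block_bound k z M)|]; [exact H| |].
  - unfold M. rewrite <- Rabs_Ropp. apply Rle_abs.
  - pose proof (block_top_mono_exp k M H). assert (0 < (9 / 10) ^ k) by (apply pow_lt; lra). nra.
Qed.

Lemma Gsum_tail_series (N : nat) (z : C) :
  is_Cseries (fun k => exp_sum (block (N + k)) z) (Gsum z - exp_sum (blocks N) z)%C.
Proof.
  induction N as [|N IH].
  - simpl. replace (Gsum z - 0)%C with (Gsum z) by ring. apply Gsum_series.
  - apply (is_series_ext (V := C_NormedModule) (fun k => exp_sum (block (N + S k)) z)).
    { intros n. do 2 f_equal. lia. }
    apply (is_series_incr_1 (V := C_NormedModule) (fun k => exp_sum (block (N + k)) z)).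
    match goal with |- is_series _ ?t => replace t with (Gsum z - exp_sum (blocks N) z)%C; [exact IH|] end.
    rewrite Nat.add_0_r. simpl blocks. rewrite exp_sum_app.
    change (Gsum z - exp_sum (blocks N) z = (Gsum z - (exp_sum (block N) z + exp_sum (blocks N) z)) + exp_sum (block N) z)%C. ring.
Qed.

(** The parameter B allows for a better growth rate when the first blocks, which
    carry the highest frequencies, are removed. *)
Lemma Gsum_tail (N : nat) (z : C) (M B : R) :
  0 <= M -> - Im z <= M -> (forall k, (N <= k)%nat -> block_top k <= B) ->
  Cmod (Gsum z - exp_sum (blocks N) z) <= 20 * (9 / 10) ^ N * exp (B * M).
Proof.
  intros HM Hz HB. pose proof (exp_pos (B * M)). assert (0 < (9 / 10) ^ N) by (apply pow_lt; lra).
  replace (20 * (9 / 10) ^ N * exp (B * M)) with ((2 * (9 / 10) ^ N * exp (B * M)) / (1 - 9 / 10)) by field.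
  apply Cseries_bound with (a := fun k => exp_sum (block (N + k)) z); [lra| nra | |apply Gsum_tail_series].
  intros k. eapply Rle_trans; [apply (block_bound _ z M HM Hz)|].
  rewrite pow_add. assert (0 < (9 / 10) ^ k) by (apply pow_lt; lra).
  pose proof (exp_le (block_top (N + k) * M) (B * M)).
  specialize (HB (N + k)%nat ltac:(lia)). specialize (H2 ltac:(nra)).
  assert (0 < (9 / 10) ^ N * (9 / 10) ^ k) by nra.
  replace (2 * (9 / 10) ^ N * exp (B * M) * (9 / 10) ^ k) with
    (2 * ((9 / 10) ^ N * (9 / 10) ^ k) * exp (B * M)) by ring. nra.
Qed.

Lemma Gsum_bound (z : C) (M : R) : 0 <= M -> - Im z <= M -> Cmod (Gsum z) <= 20 * exp (3 * M).
Proof.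
  intros HM Hz. pose proof (Gsum_tail 0 z M 3 HM Hz (fun k _ => block_top_le_3 k)) as H.
  simpl in H. replace (Gsum z - 0)%C with (Gsum z) in H by ring. lra.
Qed.

(** All coefficients are real. *)
Lemma Gsum_conj (x : R) : Gsum (- RtoC x) = Cconj (Gsum (RtoC x)).
Proof.
  unfold Gsum, Csum. apply C_eq; simpl.
  - apply Series_ext. intros k. rewrite exp_sum_real_conj by apply block_coefs_real. reflexivity.
  - rewrite <- Series_opp. apply Series_ext. intros k.
    rewrite exp_sum_real_conj by apply block_coefs_real. reflexivity.
Qed.

Lemma Gsum_upper_bound (z : C) : 0 <= Im z -> Cmod (Gsum z) <= 20.
Proof.
  intros H. pose proof (Gsum_bound z 0 ltac:(lra) ltac:(lra)) as HB.
  rewrite Rmult_0_r, exp_0 in HB. lra.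
Qed.

Lemma Gsum_real_approx (n : nat) (x : R) :
  Cmod (Gsum (RtoC x) - exp_sum (blocks n) (RtoC x)) <= 20 * (9 / 10) ^ n.
Proof.
  pose proof (Gsum_tail n (RtoC x) 0 3 ltac:(lra) ltac:(simpl; lra) (fun k _ => block_top_le_3 k)) as H.
  rewrite Rmult_0_r, exp_0 in H. lra.
Qed.

(** * Complex differentiability of the series *)

(** A quantitative form of having complex derivative D at z. A quadratic
    remainder, unlike the remainder in the definition of the derivative, sums
    well over a series of functions. *)
Definition quadratic_at (F : C -> C) (z D : C) : Prop :=
  exists K d, 0 <= K /\ 0 < d /\
    forall h, Cmod h <= d -> Cmod (F (z + h)%C - F z - h * D) <= K * Cmod h ^ 2.

Lemma quadratic_at_derive (F : C -> C) (z D : C) :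
  quadratic_at F z D -> ex_derive (V := C_NormedModule) F z.
Proof.
  intros (K & d & HK & Hd & H). exists D. split; [apply is_linear_scal_l|].
  intros x Hx. pose proof (is_filter_lim_locally_unique (V := AbsRing_NormedModule C_AbsRing) _ _ Hx) as E.
  rewrite <- E. clear x Hx E.
  intros eps.
  assert (Hr : 0 < Rmin d (eps / (K + 1))).
  { apply Rmin_pos; [exact Hd|]. apply Rdiv_lt_0_compat; [apply cond_pos|lra]. }
  exists (mkposreal _ Hr). intros y' Hy. set (y := y' : C). change y' with y in Hy |- *.
  change (Cmod (y - z) < Rmin d (eps / (K + 1))) in Hy.
  change (Cmod (F y - F z - (y - z) * D) <= eps * Cmod (y - z)).
  clearbody y. clear y'.
  specialize (H (y - z)%C). replace (z + (y - z))%C with y in H by ring.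
  pose proof (Rmin_l d (eps / (K + 1))). pose proof (Rmin_r d (eps / (K + 1))).
  eapply Rle_trans; [apply H; lra|]. pose proof (Cmod_ge_0 (y - z)).
  assert ((K + 1) * Cmod (y - z) <= eps).
  { apply Rmult_le_reg_l with (/ (K + 1)); [apply Rinv_0_lt_compat; lra|].
    rewrite <- Rmult_assoc, Rinv_l by lra. unfold Rdiv in *. lra. }
  nra.
Qed.

(** The product rule with remainder, in which T1 and T stand for the values of
    the second factor at z + h and z. *)
Lemma product_remainder (u1 T1 u T u' T' h : C) :
  (u1 * T1 - u * T - h * (u' * T + u * T') =
   (u1 - u - h * u') * T1 + (u + h * u') * (T1 - T - h * T') + h * h * (u' * T'))%C.
Proof. ring. Qed.

Lemma quadratic_at_continuous (F : C -> C) (x : R) (D : C) :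
  quadratic_at F (RtoC x) D -> continuous (fun t => F (RtoC t)) x.
Proof.
  intros (K & d & HK & Hd & HF). apply continuous_C. intros eps He.
  pose proof (Cmod_ge_0 D).
  assert (HB : 0 < Cmod D + K * d + 1) by nra.
  exists (Rmin d (eps / (Cmod D + K * d + 1))).
  split; [apply Rmin_pos; [exact Hd|apply Rdiv_lt_0_compat; lra]|].
  intros y Hy. pose proof (Rmin_l d (eps / (Cmod D + K * d + 1))).
  pose proof (Rmin_r d (eps / (Cmod D + K * d + 1))).
  specialize (HF (RtoC (y - x))). rewrite Cmod_R in HF. specialize (HF ltac:(lra)).
  rewrite RtoC_minus in HF. replace (x + (y - x))%C with (RtoC y) in HF by ring.
  replace (F (RtoC y) - F (RtoC x))%C with
    (F (RtoC y) - F (RtoC x) - (y - x) * D + (y - x) * D)%C by ring.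
  eapply Rle_trans; [apply Cmod_triangle|]. rewrite (Cmod_mult _ D), <- RtoC_minus, Cmod_R.
  rewrite <- RtoC_minus in HF.
  assert (Hb : (Cmod D + K * d + 1) * Rabs (y - x) <= eps).
  { apply Rmult_le_reg_l with (/ (Cmod D + K * d + 1)); [apply Rinv_0_lt_compat; lra|].
    rewrite <- Rmult_assoc, Rinv_l by lra. unfold Rdiv in *. lra. }
  pose proof (Rabs_pos (y - x)).
  assert (K * Rabs (y - x) ^ 2 <= K * d * Rabs (y - x)).
  { rewrite Rmult_assoc. apply Rmult_le_compat_l; [lra|]. simpl. rewrite Rmult_1_r.
    apply Rmult_le_compat_r; lra. }
  nra.
Qed.

Lemma quadratic_at_mult (F G : C -> C) (z D E : C) :
  quadratic_at F z D -> quadratic_at G z E ->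
  quadratic_at (fun z => F z * G z)%C z (D * G z + F z * E)%C.
Proof.
  intros (K & d & HK & Hd & HF) (K' & d' & HK' & Hd' & HG).
  set (B := Cmod (G z) + d' * Cmod E + K' * d' ^ 2).
  pose proof (Cmod_ge_0 (F z)). pose proof (Cmod_ge_0 D).
  pose proof (Cmod_ge_0 (G z)). pose proof (Cmod_ge_0 E).
  assert (0 <= B) by (unfold B; assert (0 <= K' * d' ^ 2) by nra; nra).
  exists (K * B + (Cmod (F z) + d * Cmod D) * K' + Cmod D * Cmod E), (Rmin d d').
  split; [|split; [apply Rmin_pos; auto|]].
  - assert (0 <= K * B) by nra. assert (0 <= Cmod (F z) + d * Cmod D) by nra. nra.
  - intros h Hh. pose proof (Rmin_l d d'). pose proof (Rmin_r d d').
    specialize (HF h ltac:(lra)). specialize (HG h ltac:(lra)).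
    pose proof (Cmod_ge_0 h).
    assert (HB : Cmod (G (z + h)%C) <= B).
    { replace (G (z + h)%C) with (G z + h * E + (G (z + h)%C - G z - h * E))%C by ring.
      eapply Rle_trans; [apply Cmod_triangle|]. unfold B. apply Rplus_le_compat.
      - eapply Rle_trans; [apply Cmod_triangle|]. rewrite Cmod_mult. nra.
      - eapply Rle_trans; [exact HG|]. apply Rmult_le_compat_l; [lra|]. apply pow_incr; lra. }
    rewrite product_remainder.
    eapply Rle_trans; [apply Cmod_triangle|]. rewrite !Rmult_plus_distr_r.
    apply Rplus_le_compat; [eapply Rle_trans; [apply Cmod_triangle|]; apply Rplus_le_compat|]; rewrite !Cmod_mult.
    + replace (K * B * Cmod h ^ 2) with (K * Cmod h ^ 2 * B) by ring.
      apply Rmult_le_compat; auto using Cmod_ge_0.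
    + replace (Cmod (F z) * K' * Cmod h ^ 2 + d * Cmod D * K' * Cmod h ^ 2) with
        ((Cmod (F z) + d * Cmod D) * (K' * Cmod h ^ 2)) by ring.
      apply Rmult_le_compat; auto using Cmod_ge_0.
      eapply Rle_trans; [apply Cmod_triangle|]. rewrite Cmod_mult. nra.
    + right. ring.
Qed.

Lemma quadratic_at_plus_const (c : C) (F : C -> C) (z D : C) :
  quadratic_at F z D -> quadratic_at (fun z => c + F z)%C z D.
Proof.
  intros (K & d & HK & Hd & HF). exists K, d. do 2 (split; [assumption|]). intros h Hh.
  replace (c + F (z + h)%C - (c + F z) - h * D)%C with (F (z + h)%C - F z - h * D)%C by ring. auto.
Qed.

Lemma quadratic_at_reflect (F : C -> C) (z D : C) :
  quadratic_at F (- z)%C D -> quadratic_at (fun z => F (- z)%C) z (- D)%C.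
Proof.
  intros (K & d & HK & Hd & HF). exists K, d. do 2 (split; [assumption|]). intros h Hh.
  specialize (HF (- h)%C). rewrite Cmod_opp in HF. specialize (HF Hh).
  replace (- (z + h))%C with (- z + - h)%C by ring.
  replace (h * - D)%C with (- h * D)%C by ring. exact HF.
Qed.

Lemma cexpi_remainder (w : R) (z h : C) :
  (cexpi w (z + h) - cexpi w z - h * (cexpi w z * (Ci * w)) =
   cexpi w z * (cexpi w h - 1 - h * (Ci * w)))%C.
Proof. rewrite cexpi_add. ring. Qed.

Lemma quadratic_at_cexpi (w : R) (z : C) : quadratic_at (cexpi w) z (cexpi w z * (Ci * w))%C.
Proof.
  exists (Cmod (cexpi w z) * (4 * w ^ 2)), (/ (2 * (Rabs w + 1))).
  pose proof (Rabs_pos w). pose proof (Cmod_ge_0 (cexpi w z)). pose proof (pow2_ge_0 w).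
  split; [nra|]. split; [apply Rinv_0_lt_compat; lra|]. intros h Hh.
  rewrite cexpi_remainder, Cmod_mult, Rmult_assoc. apply Rmult_le_compat_l; [lra|].
  rewrite Rmult_assoc. apply cexpi_taylor.
  apply (Rmult_le_compat_l (Rabs w + 1)) in Hh; [|lra].
  replace ((Rabs w + 1) * / (2 * (Rabs w + 1))) with (1 / 2) in Hh by (field; lra).
  pose proof (Cmod_ge_0 h). nra.
Qed.

Lemma exp_sum_deriv_shift (v : R) (l : list (C * R)) (z : C) :
  exp_sum (deriv_sum (shift v l)) z =
  (cexpi v z * (Ci * v) * exp_sum l z + cexpi v z * exp_sum (deriv_sum l) z)%C.
Proof.
  induction l as [|p l IH]; simpl; [ring|]. rewrite IH, cexpi_freq_add, RtoC_plus. ring.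
Qed.

Lemma exp_sum_deriv_scale (c : C) (l : list (C * R)) (z : C) :
  exp_sum (deriv_sum (scale c l)) z = (c * exp_sum (deriv_sum l) z)%C.
Proof. induction l as [|p l IH]; simpl; [ring|]. rewrite IH. ring. Qed.

Lemma rudin_shapiro_range (k : nat) :
  List.Forall (fun p : C * R => Cmod (fst p) = 1 /\ 0 <= snd p <= (1 / 4) ^ k)
    (fst (rudin_shapiro ((1 / 8) ^ k) k)).
Proof.
  apply Forall_forall. intros p Hp. split.
  - pose proof (proj1 (rudin_shapiro_coefs ((1 / 8) ^ k) k)) as H. rewrite Forall_forall in H. apply H; exact Hp.
  - assert (H : In (snd p) (map snd (fst (rudin_shapiro ((1 / 8) ^ k) k)))) by (apply in_map; exact Hp).
    rewrite (proj1 (rudin_shapiro_freqs _ _)), in_map_iff in H. destruct H as [j [<- Hj]].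
    apply in_seq in Hj. destruct Hj as [_ Hj]. simpl in Hj.
    assert (0 < (1 / 8) ^ k) by (apply pow_lt; lra).
    assert (INR j <= 2 ^ k) by (rewrite <- INR_pow2; apply le_INR; lia).
    rewrite <- pow2_pow8. pose proof (pos_INR j). split; nra.
Qed.

Section BlockEstimates.

Variables (k : nat) (z : C) (M : R).
Hypothesis (HM : 0 <= M) (Hz : - Im z <= M).

Let theta := 2 + (1 / 4) ^ k.
Let P := fst (rudin_shapiro ((1 / 8) ^ k) k).

Lemma theta_range : 0 <= theta <= 3.
Proof. unfold theta. pose proof (pow_le_1 (1 / 4) k ltac:(lra)). lra. Qed.

Lemma cexpi_theta_bound : Cmod (cexpi theta z) <= exp (3 * M).
Proof.
  pose proof theta_range. eapply Rle_trans; [apply (Cmod_cexpi_le theta z M); lra|].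
  apply exp_le. nra.
Qed.

(** The bound is needed at z + h as well as at z, whence M + 1. *)
Lemma block_poly_bound (y : C) : - Im y <= M + 1 -> Cmod (exp_sum P y) <= 2 * (3 / 2) ^ k * exp (M + 1).
Proof.
  intros Hy. unfold P.
  assert (0 < (1 / 8) ^ k) by (apply pow_lt; lra).
  eapply Rle_trans; [apply (rudin_shapiro_bound _ (M + 1)); lra|].
  apply Rmult_le_compat_l; [assert (0 < (3 / 2) ^ k) by (apply pow_lt; lra); lra|].
  apply exp_le. rewrite Rmult_minus_distr_r, pow2_pow8.
  pose proof (pow_le_1 (1 / 4) k ltac:(lra)). nra.
Qed.

Lemma pow_2_16_le : 2 ^ k * ((1 / 4) ^ k) ^ 2 <= 1.
Proof.
  rewrite <- pow_mult, Nat.mul_comm, pow_mult, <- Rpow_mult_distr.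
  apply pow_le_1. lra.
Qed.

Lemma exp_quarter_le : exp ((1 / 4) ^ k * M) <= exp M.
Proof. apply exp_le. pose proof (pow_le_1 (1 / 4) k ltac:(lra)). nra. Qed.

Lemma block_poly_deriv_bound : Cmod (exp_sum (deriv_sum P) z) <= exp M.
Proof.
  pose proof (pow_le_1 (1 / 4) k ltac:(lra)).
  eapply Rle_trans; [apply (exp_sum_bound _ ((1 / 4) ^ k) ((1 / 4) ^ k) M z); [lra|exact HM|exact Hz|]|].
  - unfold deriv_sum. apply Forall_map. eapply Forall_impl; [|apply rudin_shapiro_range].
    intros p [H1 H2]. simpl fst; simpl snd. split; [|exact H2].
    rewrite !Cmod_mult, H1, Cmod_Ci, Cmod_R, Rabs_pos_eq by lra. lra.
  - unfold deriv_sum, P. rewrite length_map, rudin_shapiro_length, INR_pow2.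
    pose proof exp_quarter_le. pose proof (exp_pos ((1 / 4) ^ k * M)).
    assert (2 ^ k * (1 / 4) ^ k <= 1) by (rewrite <- Rpow_mult_distr; apply pow_le_1; lra).
    nra.
Qed.

Lemma block_poly_taylor (h : C) : Cmod h <= 1 / 6 ->
  Cmod (exp_sum P (z + h) - exp_sum P z - h * exp_sum (deriv_sum P) z) <= 4 * exp M * Cmod h ^ 2.
Proof.
  intros Hh. pose proof (Cmod_ge_0 h). pose proof (pow_le_1 (1 / 4) k ltac:(lra)).
  eapply Rle_trans; [apply (exp_sum_taylor P ((1 / 4) ^ k) M); [exact HM|exact Hz|nra|]|].
  - eapply Forall_impl; [|apply rudin_shapiro_range]. intros p [H1 H2]. rewrite H1. lra.
  - apply Rmult_le_compat_r; [apply pow2_ge_0|]. unfold P. rewrite rudin_shapiro_length, INR_pow2.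
    pose proof pow_2_16_le. pose proof exp_quarter_le. pose proof (exp_pos ((1 / 4) ^ k * M)).
    assert (0 <= 2 ^ k * ((1 / 4) ^ k) ^ 2) by (apply Rmult_le_pos; apply pow_le; lra).
    nra.
Qed.

Lemma cexpi_theta_deriv_bound : Cmod (cexpi theta z * (Ci * theta)) <= 3 * exp (3 * M).
Proof.
  pose proof theta_range. pose proof cexpi_theta_bound.
  rewrite !Cmod_mult, Cmod_Ci, Cmod_R, Rabs_pos_eq by lra.
  pose proof (Cmod_ge_0 (cexpi theta z)). nra.
Qed.

(** The block is the product of one exponential of frequency theta, whose
    derivatives are of order one, and of a polynomial P in the slow variable
    e^(i z / 8^k). In the product rule the undifferentiated factor P keeps the
    Rudin-Shapiro bound, which (3/5)^k turns into (9/10)^k; the terms where P is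
    differentiated are of order one before weighting because the frequencies of P
    are at most (1/4)^k. The radius 1/6 ensures theta |h| <= 1/2. *)
Lemma block_taylor (h : C) : Cmod h <= 1 / 6 ->
  Cmod (exp_sum (block k) (z + h) - exp_sum (block k) z - h * exp_sum (deriv_sum (block k)) z)
    <= 83 * exp (3 * M) * exp (M + 1) * Cmod h ^ 2 * (9 / 10) ^ k.
Proof.
  intros Hh. pose proof (Cmod_ge_0 h) as Hh0. pose proof theta_range as Ht.
  unfold block. fold theta P.
  rewrite exp_sum_deriv_scale, exp_sum_deriv_shift, !exp_sum_scale, !exp_sum_shift.
  match goal with |- Cmod ?t <= _ => replace t with (RtoC ((3 / 5) ^ k) *
    (cexpi theta (z + h) * exp_sum P (z + h) - cexpi theta z * exp_sum P z - h *
     (cexpi theta z * (Ci * theta) * exp_sum P z + cexpi theta z * exp_sum (deriv_sum P) z)))%C by ring end.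
  assert (H35 : 0 < (3 / 5) ^ k <= (9 / 10) ^ k) by (split; [apply pow_lt; lra|apply pow_incr; lra]).
  rewrite Cmod_mult, Cmod_R, Rabs_pos_eq by lra.
  rewrite product_remainder, cexpi_remainder.
  set (E3 := exp (3 * M)). set (E1 := exp (M + 1)).
  assert (HE : exp M <= E1) by (apply exp_le; lra).
  assert (0 < E3) by apply exp_pos. assert (0 < E1) by apply exp_pos. pose proof (exp_pos M).
  assert (Hq : 0 < (3 / 2) ^ k) by (apply pow_lt; lra).
  set (H2 := Cmod h ^ 2). assert (0 <= H2) by apply pow2_ge_0.
  assert (B1 : Cmod (cexpi theta z * (cexpi theta h - 1 - h * (Ci * theta)) * exp_sum P (z + h))
     <= E3 * (36 * H2) * (2 * (3 / 2) ^ k * E1)).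
  { rewrite !Cmod_mult. apply Rmult_le_compat; auto using Cmod_ge_0.
    - apply Rmult_le_pos; apply Cmod_ge_0.
    - apply Rmult_le_compat; auto using Cmod_ge_0; [apply cexpi_theta_bound|].
      eapply Rle_trans; [apply cexpi_taylor; rewrite Rabs_pos_eq by lra; nra|].
      fold H2. assert (theta ^ 2 <= 9) by nra. nra.
    - apply block_poly_bound. simpl.
      pose proof (Im_le_Cmod h) as HI. apply Rabs_le_between in HI. unfold Im in *. lra. }
  assert (B2 : Cmod ((cexpi theta z + h * (cexpi theta z * (Ci * theta))) *
      (exp_sum P (z + h) - exp_sum P z - h * exp_sum (deriv_sum P) z)) <= 2 * E3 * (4 * E1 * H2)).
  { rewrite Cmod_mult. apply Rmult_le_compat; auto using Cmod_ge_0.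
    - eapply Rle_trans; [apply Cmod_triangle|]. rewrite Cmod_mult.
      pose proof cexpi_theta_bound as HA. pose proof cexpi_theta_deriv_bound as HB.
      fold E3 in HA, HB. pose proof (Cmod_ge_0 (cexpi theta z * (Ci * theta))). nra.
    - eapply Rle_trans; [apply block_poly_taylor; exact Hh|]. fold H2. nra. }
  assert (B3 : Cmod (h * h * (cexpi theta z * (Ci * theta) * exp_sum (deriv_sum P) z)) <= H2 * (3 * E3 * E1)).
  { rewrite Cmod_mult, (Cmod_mult h h). replace (Cmod h * Cmod h) with H2 by (unfold H2; ring).
    apply Rmult_le_compat_l; [assumption|].
    rewrite Cmod_mult. apply Rmult_le_compat; auto using Cmod_ge_0; [apply cexpi_theta_deriv_bound|].
    eapply Rle_trans; [apply block_poly_deriv_bound|exact HE]. }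
  match goal with |- _ * Cmod (?a + ?b + ?c) <= _ =>
    pose proof (Cmod_triangle (a + b) c) as T1; pose proof (Cmod_triangle a b) as T2 end.
  eapply Rle_trans; [apply Rmult_le_compat_l; [lra|]; eapply Rle_trans; [exact T1|];
    apply Rplus_le_compat; [eapply Rle_trans; [exact T2|]; apply Rplus_le_compat; [exact B1|exact B2]|exact B3]|].
  assert (Hpow : (3 / 5) ^ k * (3 / 2) ^ k = (9 / 10) ^ k) by (rewrite <- Rpow_mult_distr; f_equal; lra).
  replace ((3 / 5) ^ k * (E3 * (36 * H2) * (2 * (3 / 2) ^ k * E1) + 2 * E3 * (4 * E1 * H2) + H2 * (3 * E3 * E1)))
    with (E3 * E1 * H2 * (72 * ((3 / 5) ^ k * (3 / 2) ^ k) + 11 * (3 / 5) ^ k)) by ring.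
  rewrite Hpow.
  replace (83 * E3 * E1 * H2 * (9 / 10) ^ k) with (E3 * E1 * H2 * (83 * (9 / 10) ^ k)) by ring.
  apply Rmult_le_compat_l; [|lra]. apply Rmult_le_pos; [|assumption]. nra.
Qed.

(** The same splitting as for the remainder; it makes the series of derivatives
    converge. *)
Lemma block_deriv_bound :
  Cmod (exp_sum (deriv_sum (block k)) z) <= 7 * exp (3 * M) * exp (M + 1) * (9 / 10) ^ k.
Proof.
  pose proof theta_range as Ht.
  unfold block. fold theta P. rewrite exp_sum_deriv_scale, exp_sum_deriv_shift.
  assert (H35 : 0 < (3 / 5) ^ k <= (9 / 10) ^ k) by (split; [apply pow_lt; lra|apply pow_incr; lra]).
  rewrite Cmod_mult, Cmod_R, Rabs_pos_eq by lra.
  set (E3 := exp (3 * M)). set (E1 := exp (M + 1)).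
  assert (HE : exp M <= E1) by (apply exp_le; lra).
  assert (0 < E3) by apply exp_pos. assert (0 < E1) by apply exp_pos.
  assert (B1 : Cmod (cexpi theta z * (Ci * theta) * exp_sum P z) <= 3 * E3 * (2 * (3 / 2) ^ k * E1)).
  { rewrite Cmod_mult. apply Rmult_le_compat; auto using Cmod_ge_0; [apply cexpi_theta_deriv_bound|].
    apply block_poly_bound. lra. }
  assert (B2 : Cmod (cexpi theta z * exp_sum (deriv_sum P) z) <= E3 * E1).
  { rewrite Cmod_mult. apply Rmult_le_compat; auto using Cmod_ge_0; [apply cexpi_theta_bound|].
    eapply Rle_trans; [apply block_poly_deriv_bound|exact HE]. }
  eapply Rle_trans; [apply Rmult_le_compat_l; [lra|]; eapply Rle_trans; [apply Cmod_triangle|];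
    apply Rplus_le_compat; [exact B1|exact B2]|].
  assert (Hpow : (3 / 5) ^ k * (3 / 2) ^ k = (9 / 10) ^ k) by (rewrite <- Rpow_mult_distr; f_equal; lra).
  replace ((3 / 5) ^ k * (3 * E3 * (2 * (3 / 2) ^ k * E1) + E3 * E1))
    with (E3 * E1 * (6 * ((3 / 5) ^ k * (3 / 2) ^ k) + (3 / 5) ^ k)) by ring.
  rewrite Hpow. replace (7 * E3 * E1 * (9 / 10) ^ k) with (E3 * E1 * (7 * (9 / 10) ^ k)) by ring.
  apply Rmult_le_compat_l; [|lra]. nra.
Qed.

End BlockEstimates.

(** The termwise remainders have geometrically decreasing quadratic bounds, so
    their sum is the remainder of the series. Here 830 = 83 / (1 - 9/10). *)
Lemma quadratic_at_Gsum (z : C) : exists D, quadratic_at Gsum z D.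
Proof.
  set (M := Rabs (Im z)). assert (HM : 0 <= M) by apply Rabs_pos.
  assert (Hz : - Im z <= M) by (unfold M; rewrite <- Rabs_Ropp; apply Rle_abs).
  exists (Csum (fun k => exp_sum (deriv_sum (block k)) z)).
  assert (HD : is_Cseries (fun k => exp_sum (deriv_sum (block k)) z) (Csum (fun k => exp_sum (deriv_sum (block k)) z))).
  { apply is_Cseries_Csum with (K := 7 * exp (3 * M) * exp (M + 1)) (q := 9 / 10); [lra|].
    intros k. apply block_deriv_bound; assumption. }
  set (D := Csum _) in *.
  assert (HC : 0 < exp (3 * M) * exp (M + 1)) by (apply Rmult_lt_0_compat; apply exp_pos).
  exists (830 * (exp (3 * M) * exp (M + 1))), (1 / 6). split; [lra|]. split; [lra|].
  intros h Hh. pose proof (pow2_ge_0 (Cmod h)).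
  replace (830 * (exp (3 * M) * exp (M + 1)) * Cmod h ^ 2) with
    ((83 * exp (3 * M) * exp (M + 1) * Cmod h ^ 2) / (1 - 9 / 10)) by field.
  apply Cseries_bound with (a := fun k => (exp_sum (block k) (z + h) - exp_sum (block k) z
     - h * exp_sum (deriv_sum (block k)) z)%C).
  - lra.
  - rewrite (Rmult_assoc 83). apply Rmult_le_pos; [lra|assumption].
  - intros k. apply block_taylor; assumption.
  - apply (is_series_minus (V := C_NormedModule)).
    + apply (is_series_minus (V := C_NormedModule)); apply Gsum_series.
    + apply (is_series_scal (K := C_AbsRing) (V := C_NormedModule)). exact HD.
Qed.

(** * Exponential type *)

Lemma max_modulus_between (F : C -> C) (r b B : R) :
  (forall z, Cmod z <= r -> Cmod (F z) <= B) ->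
  (exists z, Cmod z <= r /\ b <= Cmod (F z)) ->
  b <= max_modulus F r <= B.
Proof.
  intros HB [z0 [Hz0 Hb]]. unfold max_modulus.
  set (E := fun y => exists z : C, Cmod z <= r /\ y = Cmod (F z)).
  destruct (Lub_Rbar_correct E) as [Hub Hlub].
  assert (H1 : Rbar_le (Lub_Rbar E) B).
  { apply Hlub. intros y [z [Hz ->]]. apply HB; exact Hz. }
  assert (H2 : Rbar_le (Cmod (F z0)) (Lub_Rbar E)) by (apply Hub; exists z0; auto).
  destruct (Lub_Rbar E); simpl in *; try tauto. lra.
Qed.

(** Constant factors disappear in (log M(r)) / r as r tends to infinity. *)
Lemma type_of_eq (F : C -> C) (tau b B r1 : R) :
  0 < b -> 0 <= tau ->
  (forall z, Cmod (F z) <= B * exp (tau * Cmod z)) ->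
  (forall r, r1 <= r -> exists z, Cmod z <= r /\ b * exp (tau * r) <= Cmod (F z)) ->
  type_of F = tau.
Proof.
  intros Hb Ht HB Hl.
  assert (Hpos : 0 < B).
  { destruct (Hl r1 (Rle_refl _)) as [z [_ Hz]]. specialize (HB z).
    pose proof (exp_pos (tau * r1)). pose proof (exp_pos (tau * Cmod z)).
    destruct (Rle_lt_dec B 0); [|assumption]. nra. }
  set (g := fun r => / r * ln (max_modulus F r)).
  assert (Hg : forall r, 0 < r -> r1 <= r -> tau + ln b / r <= g r <= tau + ln B / r).
  { intros r Hr Hr1. unfold g.
    destruct (max_modulus_between F r (b * exp (tau * r)) (B * exp (tau * r))) as [L U].
    - intros z Hz. eapply Rle_trans; [apply HB|]. apply Rmult_le_compat_l; [lra|].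
      apply exp_le. nra.
    - apply Hl; exact Hr1.
    - pose proof (exp_pos (tau * r)).
      assert (0 < b * exp (tau * r)) by nra.
      apply ln_le in U; [|lra]. apply ln_le in L; [|assumption].
      rewrite ln_mult, ln_exp in L by assumption. rewrite ln_mult, ln_exp in U by assumption.
      assert (0 < / r) by (apply Rinv_0_lt_compat; lra).
      split.
      + replace (tau + ln b / r) with (/ r * (ln b + tau * r)) by (field; lra).
        apply Rmult_le_compat_l; lra.
      + replace (tau + ln B / r) with (/ r * (ln B + tau * r)) by (field; lra).
        apply Rmult_le_compat_l; lra. }
  unfold type_of, limsup_p_infty. apply Rbar_is_glb_unique. fold g. split.
  - intros s [r0 [Hr0 ->]].
    apply Rbar_le_trans with (Lub_Rbar (fun y => exists r, r0 <= r /\ y = g r)); [|apply Rbar_le_refl].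
    destruct (Lub_Rbar_correct (fun y => exists r, r0 <= r /\ y = g r)) as [Hub _].
    destruct (Lub_Rbar (fun y => exists r, r0 <= r /\ y = g r)) as [u| |]; simpl; auto.
    + apply Rle_plus_epsilon. intros eps He.
      set (r := Rmax (Rmax r0 r1) (Rabs (ln b) / eps)).
      assert (r0 <= r) by (unfold r; eapply Rle_trans; [|apply Rmax_l]; apply Rmax_l).
      assert (r1 <= r) by (unfold r; eapply Rle_trans; [|apply Rmax_l]; apply Rmax_r).
      assert (HR : Rabs (ln b) / eps <= r) by apply Rmax_r.
      destruct (Hg r ltac:(lra) ltac:(lra)) as [L _].
      assert (g r <= u) by (apply (Hub (g r)); exists r; auto).
      assert (- eps <= ln b / r).
      { apply Rmult_le_reg_r with r; [lra|]. unfold Rdiv. rewrite Rmult_assoc, Rinv_l by lra.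
        apply (Rmult_le_compat_r eps) in HR; [|lra]. unfold Rdiv in HR.
        rewrite Rmult_assoc, Rinv_l in HR by lra. pose proof (Rle_abs (- ln b)). rewrite Rabs_Ropp in H2. lra. }
      lra.
    + exact (Hub (g r0) (ex_intro _ r0 (conj (Rle_refl _) eq_refl))).
  - intros m Hm.
    assert (HU : forall eps, 0 < eps -> Rbar_le m (tau + eps)).
    { intros eps He. set (r0 := Rmax (Rmax 1 r1) (Rabs (ln B) / eps)).
      assert (1 <= r0) by (unfold r0; eapply Rle_trans; [|apply Rmax_l]; apply Rmax_l).
      assert (r1 <= r0) by (unfold r0; eapply Rle_trans; [|apply Rmax_l]; apply Rmax_r).
      assert (HR : Rabs (ln B) / eps <= r0) by apply Rmax_r.
      eapply Rbar_le_trans; [apply Hm; exists r0; split; [lra|reflexivity]|].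
      destruct (Lub_Rbar_correct (fun y => exists r, r0 <= r /\ y = g r)) as [_ Hlub].
      apply Hlub. intros y [r [Hr ->]]. simpl.
      destruct (Hg r ltac:(lra) ltac:(lra)) as [_ U].
      assert (ln B / r <= eps).
      { apply Rmult_le_reg_r with r; [lra|]. unfold Rdiv. rewrite Rmult_assoc, Rinv_l by lra.
        apply (Rmult_le_compat_r eps) in HR; [|lra]. unfold Rdiv in HR.
        rewrite Rmult_assoc, Rinv_l in HR by lra. pose proof (Rle_abs (ln B)). nra. }
      lra. }
    destruct m as [m| |]; simpl; auto.
    + apply Rle_plus_epsilon. intros eps He. exact (HU eps He).
    + exact (HU 1 Rlt_0_1).
Qed.

(** * The spectral factor and its square *)

(** Adding a large constant c removes the zeros from the closed upper half-plane,
    where the series is bounded by 20. The frequencies of c + g fill [0, 3], and the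
    rotation by - 3/2 centres them without changing the modulus on the real line. *)
Definition factor_ext (c : R) (z : C) : C := (cexpi (- (3 / 2)) z * (c + Gsum z))%C.
(** On the real line g(-x) is the conjugate of g(x), so this is |c + g|^2. *)
Definition square_ext (c : R) (z : C) : C := ((c + Gsum z) * (c + Gsum (- z)))%C.

Definition with_const (c : R) (n : nat) : list (C * R) := (RtoC c, 0) :: blocks n.
Definition factor_sums (c : R) (n : nat) : list (C * R) := shift (- (3 / 2)) (with_const c n).
Definition square_sums (c : R) (n : nat) : list (C * R) :=
  product (with_const c n) (reflect (with_const c n)).

Lemma square_ext_real (c x : R) : square_ext c (RtoC x) = RtoC (Cmod (factor_ext c (RtoC x)) ^ 2).
Proof.
  unfold square_ext, factor_ext. rewrite Gsum_conj, Cmod_mult, cexpi_real, Cmod_chi, Rmult_1_l, Cmod2_alt.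
  apply C_eq; unfold Re, Im; simpl; ring.
Qed.

Lemma quadratic_at_factor_ext (c : R) (z : C) : exists D, quadratic_at (factor_ext c) z D.
Proof.
  destruct (quadratic_at_Gsum z) as [D HD]. eexists.
  apply quadratic_at_mult; [apply quadratic_at_cexpi|]. apply quadratic_at_plus_const. exact HD.
Qed.

Lemma quadratic_at_square_ext (c : R) (z : C) : exists D, quadratic_at (square_ext c) z D.
Proof.
  destruct (quadratic_at_Gsum z) as [D HD]. destruct (quadratic_at_Gsum (- z)) as [E HE]. eexists.
  apply quadratic_at_mult; [apply quadratic_at_plus_const; exact HD|].
  apply quadratic_at_plus_const. apply quadratic_at_reflect. exact HE.
Qed.

Lemma factor_approx (c : R) (n : nat) (x : R) :
  Cmod (factor_ext c (RtoC x) - trig_poly (factor_sums c n) x) <= 20 * (9 / 10) ^ n.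
Proof.
  unfold factor_sums. rewrite trig_poly_shift, <- exp_sum_real. unfold factor_ext.
  rewrite cexpi_real. unfold with_const. simpl exp_sum. rewrite cexpi_0.
  match goal with |- Cmod ?t <= _ => replace t with
    (chi (- (3 / 2)) x * (Gsum (RtoC x) - exp_sum (blocks n) (RtoC x)))%C by ring end.
  rewrite Cmod_mult, Cmod_chi, Rmult_1_l. apply Gsum_real_approx.
Qed.

Lemma product_approx (a b a' b' : C) (A e : R) :
  Cmod a <= A -> Cmod b' <= A -> Cmod (a - a') <= e -> Cmod (b - b') <= e ->
  Cmod (a * b - a' * b') <= 2 * A * e.
Proof.
  intros. replace (a * b - a' * b')%C with (a * (b - b') + (a - a') * b')%C by ring.
  eapply Rle_trans; [apply Cmod_triangle|]. rewrite !Cmod_mult.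
  replace (2 * A * e) with (A * e + e * A) by ring.
  apply Rplus_le_compat; apply Rmult_le_compat; auto using Cmod_ge_0.
Qed.

Lemma square_approx (c : R) (n : nat) (x : R) : 0 <= c ->
  Cmod (square_ext c (RtoC x) - trig_poly (square_sums c n) x) <= 2 * (c + 40) * (20 * (9 / 10) ^ n).
Proof.
  intros Hc. unfold square_sums. rewrite <- exp_sum_real, exp_sum_product, exp_sum_reflect.
  unfold square_ext. 
  assert (E : forall y : R, Cmod (c + Gsum (RtoC y) - exp_sum (with_const c n) (RtoC y)) <= 20 * (9 / 10) ^ n).
  { intros y. unfold with_const; simpl exp_sum. rewrite cexpi_0.
    match goal with |- Cmod ?t <= _ => replace t with
     (Gsum (RtoC y) - exp_sum (blocks n) (RtoC y))%C by ring end. apply Gsum_real_approx. }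
  assert (B : forall y : R, Cmod (c + Gsum (RtoC y)) <= c + 20).
  { intros y. eapply Rle_trans; [apply Cmod_triangle|]. rewrite Cmod_R, Rabs_pos_eq by lra.
    pose proof (Gsum_upper_bound (RtoC y) ltac:(simpl; lra)). lra. }
  rewrite <- RtoC_opp.
  apply product_approx; auto.
  - eapply Rle_trans; [apply B|lra].
  - replace (exp_sum (with_const c n) (RtoC (- x))) with
      (c + Gsum (RtoC (- x)) + - (c + Gsum (RtoC (- x)) - exp_sum (with_const c n) (RtoC (- x))))%C by ring.
    eapply Rle_trans; [apply Cmod_triangle|]. rewrite Cmod_opp.
    pose proof (B (- x)). pose proof (E (- x)). pose proof (pow_le_1 (9 / 10) n ltac:(lra)). lra.
Qed.

(** * Spectra of the factor and of its square *)

Lemma fourier_factor (c : R) (N : nat) (w : R) (v : C) :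
  (forall n, (N <= n)%nat -> coef (factor_sums c n) w = v) ->
  fourier (fun x => factor_ext c (RtoC x)) w = v.
Proof.
  intros H. apply fourier_of_approx.
  - intros x. destruct (quadratic_at_factor_ext c (RtoC x)) as [D HD].
    exact (quadratic_at_continuous _ _ _ HD).
  - intros eps He. destruct (geometric_small 20 eps ltac:(lra) He) as [N1 HN1].
    exists (factor_sums c (Nat.max N N1)). split; [apply H; lia|].
    intros x. eapply Rle_trans; [apply factor_approx|]. apply HN1. lia.
Qed.

Lemma fourier_square (c : R) (N : nat) (w : R) (v : C) : 0 <= c ->
  (forall n, (N <= n)%nat -> coef (square_sums c n) w = v) ->
  fourier (fun x => RtoC (Cmod (factor_ext c (RtoC x)) ^ 2)) w = v.
Proof.
  intros Hc H.
  assert (HS : forall x, RtoC (Cmod (factor_ext c (RtoC x)) ^ 2) = square_ext c (RtoC x))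
    by (intros; symmetry; apply square_ext_real).
  apply fourier_of_approx.
  - intros x. destruct (quadratic_at_square_ext c (RtoC x)) as [D HD].
    apply continuous_ext with (2 := quadratic_at_continuous _ _ _ HD). intros; apply square_ext_real.
  - intros eps He. destruct (geometric_small (2 * (c + 40) * 20) eps ltac:(lra) He) as [N1 HN1].
    exists (square_sums c (Nat.max N N1)). split; [apply H; lia|].
    intros x. rewrite HS. eapply Rle_trans; [apply square_approx; exact Hc|].
    rewrite <- Rmult_assoc. apply HN1. lia.
Qed.

Lemma with_const_coef (c : R) (n : nat) (w : R) : w <> 0 ->
  coef (with_const c n) w = coef (blocks n) w.
Proof. intros H. unfold with_const. simpl. destruct Req_EM_T; [exfalso; auto|reflexivity]. Qed.

Lemma with_const_coef_0 (c : R) (n : nat) : coef (with_const c n) 0 = RtoC c.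
Proof.
  unfold with_const. simpl. destruct Req_EM_T; [|tauto].
  rewrite blocks_coef_out by lra. ring.
Qed.

(** The differences of frequencies of g lie in [-1, 1], so |g|^2 contributes
    nothing at w, and only c conj(g) and c g remain. *)
Lemma square_coef (c : R) (n : nat) (w : R) : 2 <= w \/ w < -1 ->
  coef (square_sums c n) w = (c * coef (blocks n) (- w) + c * coef (blocks n) w)%C.
Proof.
  intros Hw.
  change (square_sums c n) with (scale (RtoC c) (shift 0 (reflect (with_const c n))) ++
    product (blocks n) (reflect (with_const c n))).
  rewrite coef_app, coef_scale, coef_shift, coef_reflect, with_const_coef by lra.
  replace (- (w - 0)) with (- w) by ring. f_equal.
  apply coef_product_diag. eapply Forall_impl; [|apply blocks_range].
  intros p Hp. simpl in Hp. rewrite coef_reflect. destruct Req_EM_T as [E|E].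
  - rewrite E. replace (- (w - w)) with 0 by ring. apply with_const_coef_0.
  - rewrite with_const_coef by lra. apply blocks_coef_out. lra.
Qed.

Lemma fourier_square_block (c : R) (k j : nat) : 0 <= c -> (j < 2 ^ k)%nat ->
  Cmod (fourier (fun x => RtoC (Cmod (factor_ext c (RtoC x)) ^ 2)) (block_freq k j)) = c * (3 / 5) ^ k.
Proof.
  intros Hc Hj. pose proof (block_freq_range k j Hj).
  rewrite (fourier_square c (S k) _ (c * coef (block k) (block_freq k j))%C Hc).
  - rewrite Cmod_mult, block_coef, Cmod_R, Rabs_pos_eq by assumption. reflexivity.
  - intros n Hn. rewrite square_coef, blocks_coef_in, (blocks_coef_out n (- _)) by (assumption || lra). ring.
Qed.

Lemma fourier_factor_block (c : R) (k j : nat) : (j < 2 ^ k)%nat ->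
  Cmod (fourier (fun x => factor_ext c (RtoC x)) (- (3 / 2) + block_freq k j)) = (3 / 5) ^ k.
Proof.
  intros Hj. pose proof (block_freq_range k j Hj).
  rewrite (fourier_factor c (S k) _ (coef (block k) (block_freq k j))).
  - apply block_coef; assumption.
  - intros n Hn. unfold factor_sums. rewrite coef_shift.
    replace (- (3 / 2) + block_freq k j - - (3 / 2)) with (block_freq k j) by ring.
    rewrite with_const_coef by lra. apply blocks_coef_in; assumption.
Qed.

Lemma bandwidth_square (c : R) : 0 < c ->
  bandwidth (fun x => RtoC (Cmod (factor_ext c (RtoC x)) ^ 2)) = Finite (3 - -3).
Proof.
  intros Hc. assert (H0 : (0 < 2 ^ 0)%nat) by (simpl; lia).
  apply bandwidth_eq.
  - intros w Hw. destruct (Rle_lt_dec w 3) as [H3|H3]; [destruct (Rle_lt_dec (-3) w) as [H4|H4]; [lra|]|];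
    exfalso; apply Hw; apply (fourier_square c 0); try lra; intros n _;
    rewrite square_coef, !blocks_coef_out by lra; ring.
  - apply (nonzero_of_Cmod _ (c * (3 / 5) ^ 0)); [simpl; lra|].
    rewrite (fourier_square c 1 _ (c * coef (block 0) (block_freq 0 0))%C ltac:(lra)).
    + rewrite Cmod_mult, block_coef, Cmod_R, Rabs_pos_eq by (assumption || lra). reflexivity.
    + intros n Hn. rewrite square_coef, (blocks_coef_out n (-3)) by lra.
      replace (- -3) with (block_freq 0 0) by (rewrite block_freq_0; ring).
      rewrite blocks_coef_in by (assumption || lia). ring.
  - apply (nonzero_of_Cmod _ (c * (3 / 5) ^ 0)); [simpl; lra|].
    rewrite <- block_freq_0. apply fourier_square_block; [lra|assumption].
Qed.

Lemma bandwidth_factor (c : R) : 0 < c ->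
  bandwidth (fun x => factor_ext c (RtoC x)) = Finite (3 / 2 - - (3 / 2)).
Proof.
  intros Hc. apply bandwidth_eq.
  - intros w Hw. destruct (Rle_lt_dec w (3 / 2)) as [H3|H3];
      [destruct (Rle_lt_dec (- (3 / 2)) w) as [H4|H4]; [lra|]|];
    exfalso; apply Hw; apply (fourier_factor c 0); intros n _; unfold factor_sums;
    rewrite coef_shift, with_const_coef, blocks_coef_out by lra; reflexivity.
  - apply (nonzero_of_Cmod _ c); [lra|]. rewrite (fourier_factor c 0 _ (RtoC c)).
    + rewrite Cmod_R, Rabs_pos_eq; lra.
    + intros n _. unfold factor_sums. rewrite coef_shift.
      replace (- (3 / 2) - - (3 / 2)) with 0 by ring. apply with_const_coef_0.
  - apply (nonzero_of_Cmod _ ((3 / 5) ^ 0)); [simpl; lra|].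
    assert (E : 3 / 2 = - (3 / 2) + block_freq 0 0) by (rewrite block_freq_0; lra).
    rewrite E. apply fourier_factor_block. simpl; lia.
Qed.

(** Block k alone contributes 2 ^ k A (3/5)^k = A (6/5)^k. *)
Lemma not_in_A_of_blocks (f : R -> C) (v A : R) : 0 < A ->
  (forall k j, (j < 2 ^ k)%nat -> Cmod (fourier f (v + block_freq k j)) = A * (3 / 5) ^ k) ->
  ~ in_A f.
Proof.
  intros HA H. apply not_in_A_of_unbounded. intros B.
  destruct (Pow_x_infinity (6 / 5) ltac:(rewrite Rabs_pos_eq; lra) (B / A)) as [k Hk].
  specialize (Hk k (Nat.le_refl k)).
  rewrite Rabs_pos_eq in Hk by (apply pow_le; lra).
  exists (map (fun j => v + block_freq k j) (seq 0 (2 ^ k))).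
  assert (Hp : 0 < (3 / 5) ^ k) by (apply pow_lt; lra).
  split; [|split].
  - apply Injective_map_NoDup; [|apply seq_NoDup].
    intros i j E. apply (block_freq_inj k). lra.
  - apply Forall_map. apply Forall_forall. intros j Hj. apply in_seq in Hj.
    apply (nonzero_of_Cmod _ (A * (3 / 5) ^ k)); [nra|]. apply H. lia.
  - assert (E : forall l, List.Forall (fun j => (j < 2 ^ k)%nat) l ->
      fold_right (fun w acc => Cmod (fourier f w) + acc) 0 (map (fun j => v + block_freq k j) l)
        = INR (length l) * (A * (3 / 5) ^ k)).
    { induction 1 as [|j l Hj _ IH]; [simpl; ring|].
      simpl map. simpl fold_right. change (length (j :: l)) with (S (length l)).
      rewrite IH, H, S_INR by exact Hj. ring. }
    rewrite E.
    + rewrite length_seq, INR_pow2. replace (2 ^ k * (A * (3 / 5) ^ k)) with (A * (6 / 5) ^ k).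
      2:{ replace (6 / 5) with (2 * (3 / 5)) by lra. rewrite Rpow_mult_distr. ring. }
      apply Rge_le, (Rmult_le_compat_l A) in Hk; [|lra].
      replace (A * (B / A)) with B in Hk by (field; lra). exact Hk.
    + apply Forall_forall. intros j Hj. apply in_seq in Hj. lia.
Qed.

(** * Growth and zeros of the extensions *)

(** On the closed upper half-plane the constant dominates; hence there are no
    zeros there. *)
Lemma const_plus_bounds (c : R) (z : C) : 21 <= c -> 0 <= Im z ->
  c - 20 <= Cmod (c + Gsum z) <= c + 20.
Proof.
  intros Hc Hz. pose proof (Gsum_upper_bound z Hz).
  pose proof (Cmod_sub_ge c (Gsum z)) as HL. pose proof (Cmod_triangle c (Gsum z)) as HU.
  rewrite Cmod_R, Rabs_pos_eq in HL, HU by lra. lra.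
Qed.

Lemma const_plus_growth (c M : R) (z : C) : 0 <= c -> 0 <= M -> - Im z <= M ->
  Cmod (c + Gsum z) <= (c + 20) * exp (3 * M).
Proof.
  intros Hc HM Hz. eapply Rle_trans; [apply Cmod_triangle|].
  rewrite Cmod_R, Rabs_pos_eq by lra. pose proof (Gsum_bound z M HM Hz).
  pose proof (exp_ineq1_le (3 * M)). nra.
Qed.

Lemma Cmod_imag (r : R) : 0 <= r -> Cmod (0, r) = r.
Proof.
  intros H. replace (0, r) with (RtoC r * Ci)%C by (apply C_eq; simpl; ring).
  rewrite Cmod_mult, Cmod_Ci, Cmod_R, Rabs_pos_eq; lra.
Qed.

(** The lower bound comes from the positive imaginary axis, where the series is
    bounded by 20 and the rotation e^(-3iz/2) grows like exp (3/2 r). *)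
Lemma type_of_factor_ext (c : R) : 21 <= c -> type_of (factor_ext c) = Finite (3 / 2).
Proof.
  intros Hc. apply (type_of_eq _ _ 1 (c + 20) 0); [lra|lra| |].
  - intros z. unfold factor_ext. rewrite Cmod_mult, Cmod_cexpi.
    pose proof (Im_le_Cmod z) as HI. apply Rabs_le_between in HI.
    destruct (Rle_lt_dec 0 (Im z)) as [Hy|Hy].
    + destruct (const_plus_bounds c z Hc Hy) as [_ HU]. rewrite Rmult_comm.
      apply Rmult_le_compat; auto using Cmod_ge_0; [left; apply exp_pos|]. apply exp_le. lra.
    + eapply Rle_trans; [apply Rmult_le_compat_l; [left; apply exp_pos|];
        apply (const_plus_growth c (- Im z)); lra|].
      rewrite Rmult_comm, Rmult_assoc, <- exp_plus. apply Rmult_le_compat_l; [lra|].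
      apply exp_le. lra.
  - intros r Hr. exists (0, r). rewrite Cmod_imag by exact Hr. split; [lra|].
    unfold factor_ext. rewrite Cmod_mult, Cmod_cexpi, Rmult_1_l. simpl Im.
    destruct (const_plus_bounds c (0, r) Hc Hr) as [HL _].
    replace (- (- (3 / 2) * r)) with (3 / 2 * r) by ring.
    pose proof (exp_pos (3 / 2 * r)). nra.
Qed.

(** On the positive imaginary axis c + G(z) stays away from 0, while G(-z)
    is e^(3r) up to O(e^(5r/2)), since 3 is the top frequency and all others are at
    most 5/2. *)
Lemma type_of_square_ext (c : R) : 21 <= c -> type_of (square_ext c) = Finite 3.
Proof.
  intros Hc. apply (type_of_eq _ _ (1 / 2) ((c + 20) * (c + 20)) (2 * (36 + 2 * c))); [lra|lra| |].
  - intros z. unfold square_ext. rewrite Cmod_mult.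
    pose proof (Im_le_Cmod z) as HI. apply Rabs_le_between in HI.
    assert (Hopp : Im (- z) = - Im z) by reflexivity.
    rewrite (Rmult_assoc (c + 20)).
    destruct (Rle_lt_dec 0 (Im z)) as [Hy|Hy].
    + destruct (const_plus_bounds c z Hc Hy) as [_ HU].
      apply Rmult_le_compat; auto using Cmod_ge_0.
      eapply Rle_trans; [apply (const_plus_growth c (Im z)); lra|].
      apply Rmult_le_compat_l; [lra|]. apply exp_le. lra.
    + destruct (const_plus_bounds c (- z) Hc ltac:(lra)) as [_ HU].
      rewrite Rmult_comm. apply Rmult_le_compat; auto using Cmod_ge_0.
      eapply Rle_trans; [apply (const_plus_growth c (- Im z)); lra|].
      apply Rmult_le_compat_l; [lra|]. apply exp_le. lra.
  - intros r Hr. assert (Hr0 : 0 <= r) by lra. exists (0, r). rewrite Cmod_imag by exact Hr0. split; [lra|].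
    unfold square_ext. rewrite Cmod_mult.
    destruct (const_plus_bounds c (0, r) Hc Hr0) as [HL _].
    set (y := (- (0, r))%C).
    assert (Hy : Im y = - r) by reflexivity.
    pose proof (Gsum_tail 1 y r (5 / 2) Hr0 ltac:(lra)) as HT.
    assert (HB : forall k, (1 <= k)%nat -> block_top k <= 5 / 2).
    { intros [|k] Hk; [lia|apply block_top_S]. }
    specialize (HT HB).
    assert (E1 : exp_sum (blocks 1) y = cexpi 3 y).
    { simpl. match goal with |- context [cexpi ?t y] => replace t with 3 by ring end. ring. }
    rewrite E1 in HT.
    pose proof (Cmod_cexpi 3 y) as E2. rewrite Hy in E2.
    replace (- (3 * - r)) with (r / 2 + 5 / 2 * r) in E2 by field. rewrite exp_plus in E2.
    pose proof (Cmod_sub_ge (cexpi 3 y) (Gsum y - cexpi 3 y + c)) as HS.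
    replace (cexpi 3 y + (Gsum y - cexpi 3 y + c))%C with (c + Gsum y)%C in HS by ring.
    pose proof (Cmod_triangle (Gsum y - cexpi 3 y) c) as HS2.
    rewrite (Cmod_R c), Rabs_pos_eq in HS2 by lra.
    replace (3 * r) with (r / 2 + 5 / 2 * r) by field. rewrite exp_plus.
    pose proof (exp_ineq1_le (r / 2)). pose proof (exp_ineq1_le (5 / 2 * r)).
    set (e1 := exp (r / 2)) in *. set (e2 := exp (5 / 2 * r)) in *.
    (* For r >= 2 (36 + 2 c) half of the leading term absorbs 18 e2 + c, with 18 = 20 * 9/10. *)
    assert ((36 + 2 * c) * e2 <= e1 * e2) by (apply Rmult_le_compat_r; lra).
    assert (c * 1 <= c * e2) by (apply Rmult_le_compat_l; lra).
    assert (HF : 1 / 2 * (e1 * e2) <= Cmod (c + Gsum y)) by (simpl (_ ^ 1) in HT; lra).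
    assert (0 < e1 * e2) by nra. nra.
Qed.

Theorem theorem2 :
  forall m : R, 0 < m ->
  exists f : R -> C,
    in_B f /\ ~ in_A f /\ ge_const f m /\
    exists h : R -> C,
      spectral_factor f h /\ in_B h /\ ~ in_A h.
Proof.
  intros m Hm.
  (* Then |c + g| >= c - 20 = m + 1, whose square exceeds m. *)
  set (c := m + 21). assert (Hc : 21 <= c) by (unfold c; lra).
  set (h := fun x => factor_ext c (RtoC x)). set (f := fun x => RtoC (Cmod (h x) ^ 2)).
  assert (Hmod : forall x, c - 20 <= Cmod (h x) <= c + 20).
  { intros x. unfold h, factor_ext. rewrite Cmod_mult, cexpi_real, Cmod_chi, Rmult_1_l.
    apply const_plus_bounds; [exact Hc|simpl; lra]. }
  assert (Hge : ge_const f m).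
  { intros x. split; [reflexivity|]. change (m <= Cmod (h x) ^ 2).
    destruct (Hmod x) as [HL _]. unfold c in HL. nra. }
  assert (BWf : bandwidth f = Finite (3 - -3)) by (apply bandwidth_square; lra).
  assert (BWh : bandwidth h = Finite (3 / 2 - - (3 / 2))) by (apply bandwidth_factor; lra).
  assert (Bh : in_B h).
  { split; [|rewrite BWh; exact I]. apply in_U_of_approx with (c + 20).
    - intros x. destruct (quadratic_at_factor_ext c (RtoC x)) as [D HD].
      exact (quadratic_at_continuous _ _ _ HD).
    - apply Hmod.
    - intros eps He. destruct (geometric_small 20 eps ltac:(lra) He) as [N HN].
      exists (factor_sums c N). intros x. eapply Rle_trans; [apply factor_approx|]. apply HN; lia. }
  assert (Bf : in_B f).
  { split; [|rewrite BWf; exact I]. apply in_U_of_approx with ((c + 20) ^ 2).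
    - intros x. destruct (quadratic_at_square_ext c (RtoC x)) as [D HD].
      apply continuous_ext with (2 := quadratic_at_continuous _ _ _ HD). intros; apply square_ext_real.
    - intros x. unfold f. rewrite Cmod_R, Rabs_pos_eq by apply pow2_ge_0.
      apply pow_incr. split; [apply Cmod_ge_0|apply Hmod].
    - intros eps He. destruct (geometric_small (2 * (c + 40) * 20) eps ltac:(lra) He) as [N HN].
      exists (square_sums c N). intros x. unfold f, h. rewrite <- square_ext_real.
      eapply Rle_trans; [apply square_approx; lra|]. rewrite <- Rmult_assoc. apply HN; lia. }
  exists f. split; [exact Bf|]. split; [|split; [exact Hge|]].
  - apply (not_in_A_of_blocks f 0 c); [lra|]. intros k j Hj. rewrite Rplus_0_l.
    apply fourier_square_block; [lra|exact Hj].
  - exists h. split; [|split; [exact Bh|]].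
    + split; [exact Bf|]. split.
      { exists 0. intros E. destruct (Hge 0) as [_ H0]. rewrite E in H0. simpl in H0. lra. }
      split; [intros x; destruct (Hge x); split; [assumption|lra]|].
      split; [reflexivity|].
      exists (square_ext c), (factor_ext c).
      assert (NS : forall z, 0 <= Im z -> factor_ext c z <> RtoC 0).
      { intros z Hz. unfold factor_ext. apply Cmult_neq_0; apply Cmod_gt_0.
        - rewrite Cmod_cexpi. apply exp_pos.
        - destruct (const_plus_bounds c z Hc Hz). lra. }
      split; [|split; [intros x; apply square_ext_real|split; [|split; [intros x; reflexivity|]]]].
      * split; [|split].
        -- intros z. destruct (quadratic_at_square_ext c z) as [D HD]. exact (quadratic_at_derive _ _ _ HD).
        -- exists (RtoC 0). rewrite square_ext_real. change (f 0 <> RtoC 0). intros E.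
           destruct (Hge 0) as [_ H0]. rewrite E in H0. simpl in H0. lra.
        -- rewrite type_of_square_ext by exact Hc. reflexivity.
      * split; [|split].
        -- intros z. destruct (quadratic_at_factor_ext c z) as [D HD]. exact (quadratic_at_derive _ _ _ HD).
        -- exists (RtoC 0). apply NS. simpl; lra.
        -- rewrite type_of_factor_ext by exact Hc. reflexivity.
      * rewrite BWf, type_of_factor_ext, type_of_square_ext by exact Hc. simpl.
        split; [|split; [|intros z Hz; apply NS; lra]]; f_equal; lra.
    + apply (not_in_A_of_blocks h (- (3 / 2)) 1); [lra|]. intros k j Hj. rewrite Rmult_1_l.
      apply fourier_factor_block; exact Hj.
Qed.
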